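(* (a) For every Laurent polynomial $F\in\bar{\mathbb{Q}}[x_1^{\pm1},\dots,x_d^{\pm1}]$ there exists a special hypergeometric term $\mathfrak{t}_F$ such that $G_F(z)=G_{\mathfrak{t}_F}(z)$. Consequently $G_F(z)$ is a $G$-function. (b) The Newton polytope $P_{\mathfrak{t}_F}$ is a combinatorial simplex which depends only on the monomials that appear in $F$ and not on their coefficients. (c) For every square matrix $F\in M_N(\bar{\mathbb{Q}}[x_1^{\pm1},\dots,x_d^{\pm1}])$, $G_F(z)$ is a $G$-function.
   Context: For $F\in M_N(\bar{\mathbb{Q}}[x_1^{\pm1},\dots,x_d^{\pm1}])$, $\mathrm{Tr}(F)$ denotes the constant term (coefficient of $x^0$) of the usual trace of $F$ (for $N=1$, simply the constant term of $F$), and the moment generating series is $G_F(z)=\sum_{n\ge0}\mathrm{Tr}(F^n)z^n$. A special hypergeometric term is $\mathfrak{t}_{n,k}=C_0^n\prod_{i=1}^rC_i^{k_i}\prod_{j=1}^J\binom{B_j(n,k)}{C_j(n,k)}$ with $n\in\mathbb{N}$, $k\in\mathbb{Z}^r$, $C_i$ algebraic numbers, $B_j,C_j$ integral linear forms in $(n,k)$, such that for each $n$ the support in $k$ is finite; $G_{\mathfrak{t}}(z)=\sum_{n\ge0}\big(\sum_{k\in\mathbb{Z}^r}\mathfrak{t}_{n,k}\big)z^n$. Its Newton polytope is $P_{\mathfrak{t}}=\{w\in\mathbb{R}^r: A(w)\ge0\}$ for all linear forms $A\in\{B_j,C_j,B_j-C_j\}$, where for $A(n,k)=a_0n+\sum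 a_ik_i$ one sets $A(w)=a_0+\sum a_iw_i$. A power series $G(z)=\sum a_nz^n$ is a $G$-function if (i) all $a_n$ are algebraic numbers, (ii) there is $C>0$ such that every Galois conjugate of $a_n$ has absolute value $\le C^n$ and the common denominator of $a_0,\dots,a_n$ is $\le C^n$ for all $n$, and (iii) $G$ satisfies a linear differential equation with polynomial coefficients in $z$.
   Formalization: In the definition of a G-function, the bounds by C^n on the conjugates and on the common denominator are required only for n ≥ 1; at n = 0 they would force |a_0| ≤ 1, which fails in (c) for N ≥ 2 since Tr(F^0) = N. *)

(* Defs.v *)
From HB Require Import structures.
From mathcomp Require Import all_boot all_order all_algebra all_field.
From mathcomp Require Import finmap.
From mathcomp Require Import mathcomp_extra boolp classical_sets functions.
From mathcomp Require Import cardinality fsbigop reals.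

Set Implicit Arguments.
Unset Strict Implicit.
Unset Printing Implicit Defensive.

Import Order.TTheory GRing.Theory Num.Theory.

Local Open Scope classical_set_scope.
Local Open Scope fset_scope.
Local Open Scope ring_scope.

(* Q-bar is algC.  A Laurent polynomial in d variables is a finitely supported
   function on Z^d = 'rV[int]_d, sending an exponent vector to its
   coefficient, with the convolution product. *)
Definition laurent (d : nat) : Type := {fsfun 'rV[int]_d -> algC with 0}.

HB.instance Definition _ (d : nat) := Choice.on (laurent d).

Section LaurentRing.
Variable d : nat.
Local Notation G := 'rV[int]_d.
Implicit Types (f g h : laurent d) (m x y : G).

Definition lcoef f m : algC := f m.

Lemma lcoefP f g : (forall m, lcoef f m = lcoef g m) -> f = g.
Proof. by move=> fg; apply/fsfunP. Qed.

Definition laurent_zero : laurent d := [fsfun].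

Definition laurent_add f g : laurent d :=
  [fsfun m in finsupp f `|` finsupp g => lcoef f m + lcoef g m].

Definition laurent_opp f : laurent d := [fsfun m in finsupp f => - lcoef f m].

Definition laurent_one : laurent d := [fsfun m in [fset 0] => 1].

Definition laurent_mul f g : laurent d :=
  [fsfun m in [fset x + y | x in finsupp f, y in finsupp g] =>
    \sum_(x <- finsupp f) lcoef f x * lcoef g (m - x)].

Lemma lcoef_out f m : m \notin finsupp f -> lcoef f m = 0.
Proof. exact: fsfun_dflt. Qed.

Lemma lcoef_zero m : lcoef laurent_zero m = 0.
Proof. by rewrite /lcoef fsfunE. Qed.

Lemma lcoef_add f g m : lcoef (laurent_add f g) m = lcoef f m + lcoef g m.
Proof.
rewrite {1}/lcoef fsfunE inE; case: ifPn => //; rewrite negb_or => /andP[nf ng].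
by rewrite !lcoef_out ?addr0.
Qed.

Lemma lcoef_opp f m : lcoef (laurent_opp f) m = - lcoef f m.
Proof.
by rewrite {1}/lcoef fsfunE; case: ifPn => // nf; rewrite lcoef_out ?oppr0.
Qed.

Lemma lcoef_one m : lcoef laurent_one m = (m == 0)%:R.
Proof. by rewrite /lcoef fsfunE inE; case: eqP. Qed.

Lemma lcoef_mul f g m :
  lcoef (laurent_mul f g) m
  = \sum_(x <- finsupp f) lcoef f x * lcoef g (m - x).
Proof.
rewrite {1}/lcoef fsfunE; case: ifPn => // nm; rewrite big_seq big1 // => x xf.
rewrite [lcoef g _]lcoef_out ?mulr0 //; apply: contra nm => mxg.
by apply/imfset2P; exists x => //; exists (m - x) => //; rewrite addrC subrK.
Qed.

Lemma lcoef_mul_sub f g (A : {fset G}) m : {subset finsupp f <= A} ->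
  lcoef (laurent_mul f g) m = \sum_(x <- A) lcoef f x * lcoef g (m - x).
Proof.
move=> sA; rewrite lcoef_mul; apply: big_fset_incl.
  by apply/fsubsetP.
by move=> x _ nx; rewrite lcoef_out ?mul0r.
Qed.

Fact laurent_addA : associative laurent_add.
Proof. by move=> f g h; apply: lcoefP => m; rewrite !lcoef_add addrA. Qed.

Fact laurent_addC : commutative laurent_add.
Proof. by move=> f g; apply: lcoefP => m; rewrite !lcoef_add addrC. Qed.

Fact laurent_add0 : left_id laurent_zero laurent_add.
Proof. by move=> f; apply: lcoefP => m; rewrite lcoef_add lcoef_zero add0r. Qed.

Fact laurent_addN : left_inverse laurent_zero laurent_opp laurent_add.
Proof.
by move=> f; apply: lcoefP => m; rewrite lcoef_add lcoef_opp lcoef_zero addNr.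
Qed.

HB.instance Definition _ := GRing.isZmodule.Build (laurent d)
  laurent_addA laurent_addC laurent_add0 laurent_addN.

Fact laurent_mulC : commutative laurent_mul.
Proof.
move=> f g; apply: lcoefP => m.
set B := [fset m - y | y in finsupp g].
rewrite (@lcoef_mul_sub _ _ (finsupp f `|` B)); last first.
  by move=> x xf; rewrite inE xf.
pose C := [fset m - x | x in finsupp f `|` B].
rewrite (@lcoef_mul_sub _ _ C); last first.
  move=> y yg; apply/imfsetP; exists (m - y) => /=; last by rewrite subKr.
  by rewrite inE; apply/orP; right; apply/imfsetP; exists y.
rewrite [RHS]big_imfset /=; last first.
  by move=> x y _ _ /(congr1 (fun z => m - z)); rewrite !subKr.
by apply: eq_bigr => x _; rewrite subKr mulrC.
Qed.

Fact laurent_mulA : associative laurent_mul.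
Proof.
move=> f g h; apply: lcoefP => m.
pose A := [fset x + y | x in finsupp f, y in finsupp g].
have sA : {subset finsupp (laurent_mul f g) <= A}.
  by apply/fsubsetP; exact: finsupp_sub.
rewrite (lcoef_mul_sub _ _ sA) lcoef_mul.
under [RHS]eq_bigr do rewrite lcoef_mul mulr_suml.
rewrite exchange_big /= !big_seq; apply: eq_bigr => x xf.
under [RHS]eq_bigr do rewrite -mulrA.
rewrite -mulr_sumr; congr (_ * _).
pose D := [fset y - x | y in A].
rewrite (@lcoef_mul_sub _ _ D); last first.
  move=> y yg; apply/imfsetP; exists (x + y) => /=; last by rewrite addrC addKr.
  by apply/imfset2P; exists x => //; exists y.
rewrite big_imfset /=; last by move=> y z _ _ /addIr.
by apply: eq_bigr => y _; rewrite opprB addrA subrK.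
Qed.

Fact laurent_mul1 : left_id laurent_one laurent_mul.
Proof.
move=> f; apply: lcoefP => m.
rewrite (@lcoef_mul_sub _ _ [fset 0]); last first.
  by move=> x; rewrite mem_finsupp -/(lcoef _ _) lcoef_one inE; case: (x == 0);
     rewrite ?eqxx.
by rewrite big_seq_fset1 lcoef_one eqxx mul1r subr0.
Qed.

Fact laurent_mulDl : left_distributive laurent_mul laurent_add.
Proof.
move=> f g h; apply: lcoefP => m; rewrite lcoef_add.
pose A := finsupp f `|` finsupp g.
rewrite (@lcoef_mul_sub _ _ A); last first.
  by apply/fsubsetP; exact: finsupp_sub.
rewrite (@lcoef_mul_sub f _ A); last by move=> x; rewrite inE => ->.
rewrite (@lcoef_mul_sub g _ A); last by move=> x; rewrite inE orbC => ->.
by rewrite -big_split /=; apply: eq_bigr => x _; rewrite lcoef_add mulrDl.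
Qed.

Fact laurent_one_neq0 : laurent_one != 0.
Proof.
apply/eqP => /(congr1 (fun f => lcoef f 0)).
by rewrite lcoef_one lcoef_zero eqxx => /eqP; rewrite oner_eq0.
Qed.

HB.instance Definition _ := GRing.Zmodule_isComNzRing.Build (laurent d)
  laurent_mulA laurent_mulC laurent_mul1 laurent_mulDl laurent_one_neq0.

End LaurentRing.

Local Close Scope fset_scope.

Definition const_term d (f : laurent d) : algC := lcoef f 0.

Definition monomials d (f : laurent d) : {fset 'rV[int]_d} := finsupp f.

(* A formal power series over Q-bar is its sequence of coefficients. *)
Definition moment_series d (F : laurent d) : nat -> algC :=
  fun n => const_term (F ^+ n).

Definition moment_series_mx d N (F : 'M[laurent d]_N) : nat -> algC :=
  fun n => const_term (\tr (F ^+ n)).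

(* (a0, a) stands for the integral linear form a0 * n + \sum_i a_i * k_i. *)
Definition linform (r : nat) : Type := (int * 'rV[int]_r)%type.

Definition lf_eval r (A : linform r) (n : nat) (k : 'rV[int]_r) : int :=
  A.1 * n%:Z + \sum_(i < r) A.2 0 i * k 0 i.

Definition lf_affine (R : realType) r (A : linform r) (w : 'rV[R]_r) : R :=
  A.1%:~R + \sum_(i < r) (A.2 0 i)%:~R * w 0 i.

(* Vanishes unless 0 <= c <= b, which is the convention that makes n * P_t
   contain the support of t_{n,-}. *)
Definition binomz (b c : int) : nat :=
  if (0 <= c <= b) then 'C(`|b|, `|c|) else 0%N.

(* st_binoms lists the pairs of forms (B_j, C_j). *)
Record pre_special_term := PreSpecialTerm {
  st_rank : nat;
  st_C0 : algC;
  st_C : 'I_st_rank -> algC;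
  st_binoms : seq (linform st_rank * linform st_rank)
}.

Definition st_val (t : pre_special_term) (n : nat) (k : 'rV[int]_(st_rank t)) :
    algC :=
  st_C0 t ^+ n * (\prod_(i < st_rank t) st_C i ^ (k 0 i)) *
  \prod_(bc <- st_binoms t) (binomz (lf_eval bc.1 n k) (lf_eval bc.2 n k))%:R.

(* The exponents k_i range over Z, so C_1, ..., C_r have to be invertible for
   C_i ^ k_i to make sense; C_0 only occurs with exponents in nat. *)
Record special_term := SpecialTerm {
  st_pre :> pre_special_term;
  st_C_neq0 : forall i, st_C (p := st_pre) i != 0;
  st_finite : forall n : nat, finite_set [set k | st_val (t := st_pre) n k != 0]
}.

Definition special_series (t : special_term) : nat -> algC :=
  fun n => \sum_(k \in [set: 'rV[int]_(st_rank t)]) st_val (t := t) n k.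

Definition newton_polytope (R : realType) (t : special_term) :
    set 'rV[R]_(st_rank t) :=
  [set w | forall bc, bc \in st_binoms t ->
     [/\ 0 <= lf_affine bc.1 w, 0 <= lf_affine bc.2 w
       & 0 <= lf_affine (bc.1 - bc.2) w]].

Section CombinatorialSimplex.
Variable R : realType.

Definition dotp r (u w : 'rV[R]_r) : R := \sum_(i < r) u 0 i * w 0 i.

(* With u = 0 this includes P itself (b = 0) and the empty face (b = 1). *)
Definition is_face r (P F : set 'rV[R]_r) : Prop :=
  exists (u : 'rV[R]_r) (b : R),
    (forall w, P w -> dotp u w <= b) /\ F = [set w | P w /\ dotp u w = b].

Definition std_simplex (m : nat) : set 'rV[R]_m.+1 :=
  [set w | (forall i, 0 <= w 0 i) /\ \sum_(i < m.+1) w 0 i = 1].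

Definition combinatorially_equivalent p q
    (P : set 'rV[R]_p) (Q : set 'rV[R]_q) : Prop :=
  exists phi : set 'rV[R]_p -> set 'rV[R]_q,
    set_bij (is_face P) (is_face Q) phi /\
    forall F F', is_face P F -> is_face P F' ->
      (F `<=` F' <-> phi F `<=` phi F').

Definition is_bounded r (P : set 'rV[R]_r) : Prop :=
  exists M : R, forall w, P w -> forall i, `|w 0 i| <= M.

(* P is meant to be a polyhedron, so that boundedness makes it a polytope. *)
Definition combinatorial_simplex r (P : set 'rV[R]_r) : Prop :=
  is_bounded P /\ exists m : nat, combinatorially_equivalent P (@std_simplex m).

End CombinatorialSimplex.

Definition galois_conjugate (x y : algC) : Prop := root (minCpoly x) y.

Definition clears_denominators (a : nat -> algC) (n D : nat) : Prop :=
  (0 < D)%N /\ forall i, (i <= n)%N -> D%:R * a i \in Aint.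

Definition common_denominator (a : nat -> algC) (n D : nat) : Prop :=
  clears_denominators a n D /\
  forall D', clears_denominators a n D' -> (D <= D')%N.

Definition ps_deriv (a : nat -> algC) : nat -> algC :=
  fun n => n.+1%:R * a n.+1.

Definition ps_mulp (p : {poly algC}) (a : nat -> algC) : nat -> algC :=
  fun n => \sum_(j < n.+1) p`_j * a (n - j)%N.

Definition satisfies_linear_ode (a : nat -> algC) : Prop :=
  exists (m : nat) (p : 'I_m -> {poly algC}),
    (exists i, p i != 0) /\
    forall n, \sum_(i < m) ps_mulp (p i) (iter i ps_deriv a) n = 0.

(* Algebraicity of the coefficients is built into algC.  The growth conditions
   are imposed for n >= 1: at n = 0 they would force every conjugate of a_0 to
   have absolute value at most 1, whereas Tr(F^0) = N. *)
Definition G_function (a : nat -> algC) : Prop :=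
  (exists C : algC, 0 < C /\
     forall n, (0 < n)%N ->
       (forall y, galois_conjugate (a n) y -> `|y| <= C ^+ n) /\
       (exists D, common_denominator a n D /\ D%:R <= C ^+ n)) /\
  satisfies_linear_ode a.

(* Main.v *)
Require Import Defs.
From HB Require Import structures.
From mathcomp Require Import all_boot all_order all_algebra all_field.
From mathcomp Require Import finmap boolp classical_sets functions.
From mathcomp Require Import cardinality fsbigop reals.
From mathcomp Require Import zify ring.

(* Put u_i = 1 + x_i and v_i = 1 + 1/x_i.  Since x_i = u_i - 1 and
   1/x_i = v_i - 1, every Laurent polynomial is a linear combination of products
   u^a v^b, and the constant term of u^a v^b is the product over i of
   C(a_i + b_i, a_i).  The multinomial expansion of F^n in these products is
   therefore a special hypergeometric term without any linear constraint on the
   summation indices besides |k| = n, so its Newton polytope is the standard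
   simplex.

   For the differential equation, let h be the generating series of
   tr(F^n) / (x_1 ... x_d).  By Cayley-Hamilton P h is a polynomial, where P is
   the reversed characteristic polynomial of F, so h is rational in z and x.  A
   dimension count produces a nonzero operator in z, d/dz and the d/dx_i, free of
   the x_i, that annihilates h; taking a suitable coefficient in x turns it into
   an operator in z and d/dz that annihilates the residue of h, which is the
   moment series.  The growth conditions follow by conjugating F by the
   automorphisms of the algebraic numbers and by clearing the denominators of the
   coefficients of F. *)

Set Implicit Arguments.
Unset Strict Implicit.
Unset Printing Implicit Defensive.

Import Order.TTheory GRing.Theory Num.Theory.

Local Open Scope ring_scope.

(** * Coefficients and monomials of Laurent polynomials *)

Section LaurentCoefficients.
Variable d : nat.
Implicit Types (f g : laurent d) (m a : 'rV[int]_d).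

Lemma lcoefD f g m : lcoef (f + g) m = lcoef f m + lcoef g m.
Proof. exact: lcoef_add. Qed.

Lemma lcoefN f m : lcoef (- f) m = - lcoef f m.
Proof. exact: lcoef_opp. Qed.

Lemma lcoef0 m : @lcoef d 0 m = 0.
Proof. exact: lcoef_zero. Qed.

Lemma lcoef1 m : @lcoef d 1 m = (m == 0)%:R.
Proof. exact: lcoef_one. Qed.

Lemma lcoefM f g m :
  lcoef (f * g) m = \sum_(x <- finsupp f) lcoef f x * lcoef g (m - x).
Proof. exact: lcoef_mul. Qed.

Lemma lcoef_sum I (r : seq I) (P : pred I) (F : I -> laurent d) m :
  lcoef (\sum_(i <- r | P i) F i) m = \sum_(i <- r | P i) lcoef (F i) m.
Proof.
exact: (big_morph (fun f => lcoef f m) (fun f g => lcoefD f g m) (lcoef0 m)).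
Qed.

Lemma lcoefMn f n m : lcoef (f *+ n) m = lcoef f m *+ n.
Proof.
elim: n => [|n IHn]; first by rewrite !mulr0n lcoef0.
by rewrite !mulrS lcoefD IHn.
Qed.

Definition lmono (c : algC) a : laurent d := [fsfun m in [fset a]%fset => c].

Lemma lcoef_lmono c a m : lcoef (lmono c a) m = c *+ (m == a).
Proof. by rewrite /lcoef fsfunE inE; case: eqP. Qed.

Lemma lcoef_lmonoM c a f m : lcoef (lmono c a * f) m = c * lcoef f (m - a).
Proof.
rewrite (@lcoef_mul_sub _ _ _ [fset a]%fset); last first.
  move=> x; rewrite mem_finsupp -/(lcoef _ _) lcoef_lmono inE.
  by case: (x == a); rewrite ?mulr0n ?eqxx.
by rewrite big_seq_fset1 lcoef_lmono eqxx.
Qed.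

Lemma lmonoM c1 c2 a1 a2 :
  lmono c1 a1 * lmono c2 a2 = lmono (c1 * c2) (a1 + a2).
Proof.
apply: lcoefP => m; rewrite lcoef_lmonoM !lcoef_lmono subr_eq [a2 + a1]addrC.
by rewrite mulrnAr.
Qed.

Lemma lmono1 : lmono 1 0 = 1.
Proof. by []. Qed.

Lemma lmonoXn c a n : lmono c a ^+ n = lmono (c ^+ n) (a *+ n).
Proof.
elim: n => [|n IHn]; first by rewrite !expr0 mulr0n lmono1.
by rewrite exprS IHn lmonoM -exprS -mulrS.
Qed.

Lemma lmono_prod I (r : seq I) (c : I -> algC) (a : I -> 'rV[int]_d) :
  \prod_(i <- r) lmono (c i) (a i) = lmono (\prod_(i <- r) c i) (\sum_(i <- r) a i).
Proof.
elim: r => [|i r IHr]; first by rewrite !big_nil lmono1.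
by rewrite !big_cons IHr lmonoM.
Qed.

Lemma laurent_lmonoE f : f = \sum_(a <- finsupp f) lmono (lcoef f a) 0 * lmono 1 a.
Proof.
apply: lcoefP => m; rewrite lcoef_sum.
under eq_bigr do rewrite lmonoM mulr1 add0r lcoef_lmono.
have [mf|mf] := boolP (m \in finsupp f).
  rewrite (big_fsetD1 m) //= eqxx big_seq big1 ?addr0 // => a.
  by rewrite !inE eq_sym => /andP[/negbTE-> _].
rewrite lcoef_out // big_seq big1 // => a af.
by case: eqP => // ma; rewrite ma af in mf.
Qed.

End LaurentCoefficients.

(** * Expansion in products of [1 + x_i] and [1 + 1/x_i] *)

Section ShiftedMonomials.
Variable d : nat.
Implicit Types (i j : 'I_d) (m : 'rV[int]_d) (a b : 'I_d -> nat).

Definition evec i : 'rV[int]_d := delta_mx 0 i.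

Lemma evecE i j : evec i 0 j = (j == i)%:R.
Proof. by rewrite mxE eqxx. Qed.

(** The value 0 at negative [z] keeps Pascal's rule valid on all of Z, so coefficients can be read
    off at every exponent vector. *)
Definition binz (n : nat) (z : int) : nat :=
  if z is Posz k then 'C(n, k) else 0%N.

Lemma binz0 z : binz 0 z = (z == 0).
Proof. by case: z => [[|k]|k]. Qed.

Lemma binzS n z : binz n.+1 z = (binz n z + binz n (z - 1))%N.
Proof.
case: z => [[|k]|k]; first by rewrite /= !bin0.
  by rewrite (_ : Posz k.+1 - 1 = k) ?[RHS]/= -?binS //; lia.
by rewrite (_ : Negz k - 1 = Negz k.+1) //; lia.
Qed.

Definition lx i : laurent d := lmono 1 (evec i).
Definition lxV i : laurent d := lmono 1 (- evec i).

(** A list of factors allows induction one factor at a time: a new factor [1 + x_i] acts by Pascal's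
    rule on coordinate [i] and leaves the others alone. *)
Lemma lcoef_prod_1px (s : seq 'I_d) m :
  lcoef (\prod_(i <- s) (1 + lx i)) m
  = (\prod_i binz (count_mem i s) (m 0%R i))%:R.
Proof.
elim: s m => [|i s IHs] m.
  rewrite big_nil lcoef1; congr _%:R.
  under eq_bigr do rewrite binz0.
  have [->|m0] := eqVneq m 0.
    by rewrite big1 // => i _; rewrite mxE eqxx.
  have [i mi0] : exists i, m 0 i != 0.
    apply/existsP; apply: contraR m0; rewrite negb_exists => /forallP m0.
    by apply/eqP/rowP => i; rewrite mxE; apply/eqP/negPn/m0.
  by rewrite (bigD1 i) //= (negbTE mi0) mul0n.
rewrite big_cons mulrDl mul1r lcoefD lcoef_lmonoM mul1r !IHs -natrD.
congr _%:R; rewrite (bigD1 i) //= [X in (_ + X)%N](bigD1 i) //=.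
rewrite [RHS](bigD1 i) //= eqxx add1n binzS mulnDl !mxE !eqxx /=.
by congr (_ * _ + _ * _)%N; apply: eq_bigr => j ji;
  rewrite ?mxE ?(negbTE ji) ?andbF ?subr0 // eq_sym (negbTE ji).
Qed.

Lemma lcoef_prod_1pxX a m :
  lcoef (\prod_i (1 + lx i) ^+ a i) m = (\prod_i binz (a i) (m 0%R i))%:R.
Proof.
pose s := flatten [seq nseq (a i) i | i <- enum 'I_d].
have -> : \prod_i (1 + lx i) ^+ a i = \prod_(i <- s) (1 + lx i).
  rewrite big_flatten big_map big_enum /=.
  by apply: eq_bigr => i _; rewrite big_nseq iter_mulr_1.
rewrite lcoef_prod_1px; congr _%:R; apply: eq_bigr => i _; congr binz.
rewrite count_flatten -map_comp sumnE big_map big_enum /= (bigD1 i) //=.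
rewrite count_nseq /= eqxx mul1n big1 ?addn0 // => j ji.
by rewrite count_nseq /= (negbTE ji).
Qed.

Definition uvmono a b : laurent d :=
  \prod_i ((1 + lx i) ^+ a i * (1 + lxV i) ^+ b i).

(** As [1 + 1/x = x^-1 (1 + x)], the product is [x^-b (1 + x)^(a + b)], and its constant term is the
    coefficient of [x^b] in [(1 + x)^(a + b)]. *)
Lemma const_term_uvmono a b :
  const_term (uvmono a b) = (\prod_i 'C(a i + b i, a i))%:R.
Proof.
have -> : uvmono a b
    = lmono 1 (- \sum_i evec i *+ b i) * \prod_i (1 + lx i) ^+ (a i + b i).
  have vE i : 1 + lxV i = lxV i * (1 + lx i).
    by rewrite mulrDr mulr1 lmonoM mul1r addNr lmono1 addrC.
  transitivity (\prod_i ((lxV i) ^+ b i * (1 + lx i) ^+ (a i + b i))).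
    apply: eq_bigr => i _.
    by rewrite vE exprMn mulrCA -exprD.
  rewrite big_split /=; congr (_ * _).
  under eq_bigr do rewrite lmonoXn expr1n mulNrn.
  by rewrite lmono_prod sumrN big1.
rewrite /const_term lcoef_lmonoM mul1r sub0r opprK lcoef_prod_1pxX.
congr _%:R; apply: eq_bigr => i _.
rewrite summxE (bigD1 i) //= mulmxnE evecE eqxx big1 ?addr0 => [|j ji].
  by rewrite mulr1n natz /= -[RHS]bin_sub ?leq_addr // addKn.
by rewrite mulmxnE evecE eq_sym (negbTE ji) mul0rn.
Qed.

Lemma uvmonoM a b a' b' : uvmono a b * uvmono a' b'
  = uvmono (fun i => a i + a' i)%N (fun i => b i + b' i)%N.
Proof.
by rewrite /uvmono -big_split /=; apply: eq_bigr => i _; rewrite !exprD mulrACA.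
Qed.

Lemma uvmonoX a b n :
  uvmono a b ^+ n = uvmono (fun i => n * a i)%N (fun i => n * b i)%N.
Proof.
rewrite /uvmono -prodrXl; apply: eq_bigr => i _.
by rewrite exprMn -!exprM ![(n * _)%N]mulnC.
Qed.

Definition uvterm : Type := (algC * (('I_d -> nat) * ('I_d -> nat)))%type.

Definition uvval (t : uvterm) : laurent d := lmono t.1 0 * uvmono t.2.1 t.2.2.

(** Nonzero coefficients are required because they become the constants [C_i] of a special term,
    which must be invertible. *)
Definition uv_expansion (f : laurent d) (E : seq uvterm) : Prop :=
  all (fun t => t.1 != 0) E /\ f = \sum_(t <- E) uvval t.

Definition uvterm_mul (t t' : uvterm) : uvterm :=
  (t.1 * t'.1,
    (fun i => t.2.1 i + t'.2.1 i, fun i => t.2.2 i + t'.2.2 i)%N).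

Lemma uvval_mul t t' : uvval (uvterm_mul t t') = uvval t * uvval t'.
Proof. by rewrite /uvval mulrACA lmonoM addr0 uvmonoM. Qed.

Lemma uv_expansion1 : uv_expansion 1 [:: (1, (fun=> 0%N, fun=> 0%N))].
Proof.
split; first by rewrite /= oner_neq0.
rewrite big_seq1 /uvval lmono1 mul1r /uvmono big1 // => i _.
by rewrite !expr0 mulr1.
Qed.

Lemma uv_expansionM f g E E' : uv_expansion f E -> uv_expansion g E' ->
  uv_expansion (f * g) [seq uvterm_mul t t' | t <- E, t' <- E'].
Proof.
move=> [E0 ->] [E'0 ->]; split.
  apply/all_allpairsP => t t' /(allP E0) t0 /(allP E'0) t'0.
  by rewrite mulf_neq0.
rewrite big_allpairs_dep /= mulr_suml; apply: eq_bigr => t _.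
by rewrite mulr_sumr; apply: eq_bigr => t' _; rewrite uvval_mul.
Qed.

Lemma uv_expansion_lx i : exists E, uv_expansion (lx i) E.
Proof.
exists [:: (1, (fun j => (j == i) : nat, fun=> 0%N));
           (-1, (fun=> 0%N, fun=> 0%N))].
split; first by rewrite /= oppr_eq0 oner_neq0.
rewrite big_cons big_seq1 /uvval /= lmono1 mul1r /uvmono.
rewrite (bigD1 i) //= eqxx big1 => [|j /negbTE->]; last by rewrite mulr1.
rewrite big1 => [|j _]; last by rewrite !expr0 mulr1.
have -> : lmono (-1) 0 = - 1 :> laurent d.
  by rewrite -lmono1; apply: lcoefP => m; rewrite lcoefN !lcoef_lmono mulNrn.
by rewrite expr1 expr0 !mulr1 addrAC subrr add0r.
Qed.

Lemma uv_expansion_lxV i : exists E, uv_expansion (lxV i) E.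
Proof.
exists [:: (1, (fun=> 0%N, fun j => (j == i) : nat));
           (-1, (fun=> 0%N, fun=> 0%N))].
split; first by rewrite /= oppr_eq0 oner_neq0.
rewrite big_cons big_seq1 /uvval /= lmono1 mul1r /uvmono.
rewrite (bigD1 i) //= eqxx big1 => [|j /negbTE->]; last by rewrite mulr1.
rewrite big1 => [|j _]; last by rewrite !expr0 mulr1.
have -> : lmono (-1) 0 = - 1 :> laurent d.
  by rewrite -lmono1; apply: lcoefP => m; rewrite lcoefN !lcoef_lmono mulNrn.
by rewrite expr1 expr0 mul1r !mulr1 addrAC subrr add0r.
Qed.

Lemma uv_expansionX f n : (exists E, uv_expansion f E) ->
  exists E, uv_expansion (f ^+ n) E.
Proof.
move=> [E fE]; elim: n => [|n [E' fE']]; first by eexists; exact: uv_expansion1.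
by rewrite exprS; eexists; exact: uv_expansionM fE fE'.
Qed.

Lemma uv_expansion_lmono (a : 'rV[int]_d) : exists E, uv_expansion (lmono 1 a) E.
Proof.
have -> : lmono 1 a = \prod_i lmono 1 (a 0 i *: evec i).
  by rewrite lmono_prod big1 // [in LHS](row_sum_delta a).
elim/big_ind: _ => [|f g [E fE] [E' gE']|i _].
- by eexists; exact: uv_expansion1.
- by eexists; exact: uv_expansionM fE gE'.
case: (a 0 i) => n.
  rewrite -[1](expr1n _ n) -natz scaler_nat -lmonoXn.
  exact/uv_expansionX/uv_expansion_lx.
rewrite NegzE -[1](expr1n _ n.+1) -natz scaleNr scaler_nat -mulNrn -lmonoXn.
exact/uv_expansionX/uv_expansion_lxV.
Qed.

(* The two cancelling constants keep the expansion nonempty when f = 0. *)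
Lemma uv_expansion_exists : exists E : laurent d -> seq uvterm,
  (forall f, uv_expansion f (E f) /\ (0 < size (E f))%N) /\
  (forall f g, monomials f = monomials g -> size (E f) = size (E g)).
Proof.
(* One expansion per monomial is fixed once and for all, so the number of terms of [E f] depends
   only on the support of [f]. *)
have [E0 E0P] := choice uv_expansion_lmono.
pose c0 (c : algC) : uvterm := (c, (fun=> 0%N, fun=> 0%N)).
pose E (f : laurent d) := [:: c0 1; c0 (-1)] ++
  [seq uvterm_mul (c0 (lcoef f m)) t | m <- finsupp f, t <- E0 m].
have uvval_c0 c : uvval (c0 c) = lmono c 0.
  by rewrite /uvval /uvmono big1 ?mulr1 // => i _; rewrite !expr0 mulr1.
exists E; split=> [f|f g].
  split=> //; split.
    rewrite /E all_cat /= oppr_eq0 oner_neq0 /=.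
    apply/all_allpairsP => a t; rewrite mem_finsupp -/(lcoef f a) => fa tE.
    by rewrite mulf_neq0 //; case: (E0P a) => /allP/(_ t tE).
  rewrite /E /= !big_cons !uvval_c0 addrA.
  have -> : lmono 1 0 + lmono (-1) 0 = 0 :> laurent d.
    by apply: lcoefP => m; rewrite lcoefD !lcoef_lmono -mulrnDl subrr mul0rn lcoef0.
  rewrite add0r big_allpairs_dep [LHS]laurent_lmonoE; apply: eq_bigr => a _.
  rewrite [in LHS](E0P a).2 mulr_sumr; apply: eq_bigr => t _.
  by rewrite uvval_mul uvval_c0.
rewrite /monomials => fg; rewrite /E !size_cat !size_allpairs_dep fg.
by [].
Qed.

End ShiftedMonomials.

(** * Compositions and the multinomial theorem *)

Fixpoint compositions (s n : nat) : seq (seq nat) :=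
  if s is s'.+1 then [seq k :: l | k <- iota 0 n.+1, l <- compositions s' (n - k)]
  else if n == 0 then [:: [::]] else [::].

Lemma compositionsS s n : compositions s.+1 n
  = [seq k :: l | k <- iota 0 n.+1, l <- compositions s (n - k)].
Proof. by []. Qed.

Lemma mem_compositions s n l :
  (l \in compositions s n) = (size l == s) && (sumn l == n).
Proof.
elim: s n l => [|s IHs] n l.
  rewrite /=; case: n => [|n]; last by case: l.
  by case: l => [|k l]; rewrite ?inE.
rewrite compositionsS.
apply/allpairsPdep/andP => [[k [l' [+ + ->]]]|].
  rewrite mem_iota add0n ltnS IHs => /andP[_ kn] /andP[/eqP /= -> /eqP /= ->].
  by rewrite eqxx subnKC ?eqxx.
case: l => [[]|k l] // [/eqP[ls] /eqP<-].
exists k, l; split=> //; first by rewrite mem_iota ltnS /= leq_addr.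
by rewrite IHs ls /= addKn !eqxx.
Qed.

Lemma uniq_compositions s n : uniq (compositions s n).
Proof.
elim: s n => [|s IHs] n; first by rewrite /=; case: ifP.
rewrite compositionsS.
apply: allpairs_uniq_dep => [|k _|]; [exact: iota_uniq|exact: IHs|].
by move=> [k1 l1] [k2 l2] _ _ /= [-> ->].
Qed.

(** The usual multinomial coefficient, factored into binomials because these are the only
    combinatorial factors of a special term. *)
Fixpoint multinomial (l : seq nat) : nat :=
  if l is k :: l' then ('C(k + sumn l', k) * multinomial l')%N else 1%N.

Lemma multinomialE (l : seq nat) :
  multinomial l = (\prod_(i < size l) 'C(sumn (drop i l), nth 0%N l i))%N.
Proof.
elim: l => [|k l IHl] /=; first by rewrite big_ord0.
by rewrite big_ord_recl /= IHl.
Qed.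

(** Induction on the number of summands: the binomial theorem splits off the first one. *)
Lemma expr_sum_multinomial (R : comNzRingType) (s n : nat) (f : nat -> R) :
  (\sum_(i < s) f i) ^+ n = \sum_(l <- compositions s n)
    (\prod_(i < s) f i ^+ nth 0%N l i) *+ multinomial l.
Proof.
elim: s n f => [|s IHs] n f.
  rewrite !big_ord0 expr0n /=; case: n => [|n] /=; last by rewrite big_nil.
  by rewrite big_seq1 big_ord0.
rewrite big_ord_recl addrC exprDn compositionsS big_allpairs_dep.
rewrite -[iota 0 n.+1]/(index_iota 0 n.+1) big_mkord; apply: eq_bigr => k _.
rewrite (IHs _ (fun i => f i.+1)) mulr_suml -sumrMnl !big_seq.
apply: eq_bigr => l; rewrite mem_compositions => /andP[_ /eqP ln].
rewrite big_ord_recl /= ln subnKC; last by rewrite -ltnS.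
rewrite mulrnAl -mulrnA mulnC.
by rewrite mulrC.
Qed.

(** * The special hypergeometric term of an expansion *)

Section UVSpecialTerm.
Variables (d s : nat) (c : nat -> uvterm d).
Hypothesis c_neq0 : forall i, (i < s)%N -> (c i).1 != 0.
Implicit Types (l : seq nat) (k : 'rV[int]_s).

Definition form_n : linform s := (1, 0).
Definition form_sum : linform s := (0, const_mx 1).
Definition form_tail (i : 'I_s) : linform s := (0, \row_j (i <= j)%N%:R).
Definition form_coord (i : 'I_s) : linform s := (0, delta_mx 0 i).
Definition form_u (i : 'I_d) : linform s := (0, \row_j ((c j).2.1 i)%:R).
Definition form_uv (i : 'I_d) : linform s :=
  (0, \row_j ((c j).2.1 i + (c j).2.2 i)%:R).

(** The first two binomials vanish unless [|k| = n], and are then 1. The tail binomials multiply to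
    the multinomial coefficient and force [k >= 0]. The last family gives the constant term of the
    product [u^a v^b] selected by [k]. *)
Definition uv_binoms : seq (linform s * linform s) :=
  [:: (form_n, form_sum); (form_sum, form_n)]
  ++ [seq (form_tail i, form_coord i) | i <- index_enum 'I_s]
  ++ [seq (form_uv i, form_u i) | i <- index_enum 'I_d].

Definition uv_pre_term : pre_special_term :=
  @PreSpecialTerm s 1 (fun i => (c i).1) uv_binoms.

Definition comp_row l : 'rV[int]_s := \row_i (nth 0%N l i)%:Z.

Lemma lf_eval_nat (a : 'I_s -> nat) n l :
  lf_eval (0, \row_j (a j)%:R) n (comp_row l)
  = Posz (\sum_(j < s) a j * nth 0%N l j)%N.
Proof.
rewrite /lf_eval /= mul0r add0r (big_morph Posz PoszD (erefl _)).
by apply: eq_bigr => j _; rewrite !mxE natz PoszM.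
Qed.

Lemma lf_eval_n n k : lf_eval form_n n k = n.
Proof.
rewrite /lf_eval /= mul1r big1 ?addr0 // => i _.
by rewrite mxE mul0r.
Qed.

Lemma lf_eval_sum n k : lf_eval form_sum n k = \sum_i k 0 i.
Proof.
rewrite /lf_eval /= mul0r add0r; apply: eq_bigr => i _.
by rewrite mxE mul1r.
Qed.

Lemma lf_eval_coord i n k : lf_eval (form_coord i) n k = k 0 i.
Proof.
rewrite /lf_eval /= mul0r add0r (bigD1 i) //= mxE !eqxx mul1r.
by rewrite big1 ?addr0 // => j ji; rewrite mxE eqxx (negbTE ji) mul0r.
Qed.

Lemma sumn_drop l i :
  sumn (drop i l) = (\sum_(j < size l) (i <= j)%N * nth 0%N l j)%N.
Proof.
elim: l i => [|k l IHl] [|i] //=; rewrite ?big_ord0 //.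
  rewrite big_ord_recl /= mul1n; congr (_ + _)%N.
  by rewrite -{1}[l]drop0 IHl.
by rewrite big_ord_recl /= mul0n add0n IHl.
Qed.

Lemma lf_eval_tail i n l : size l = s ->
  lf_eval (form_tail i) n (comp_row l) = sumn (drop i l).
Proof.
by move=> ls; rewrite (lf_eval_nat (fun j => (i <= j)%N : nat)) sumn_drop ls.
Qed.

Lemma binomz_nat (a b : nat) : binomz a b = 'C(a, b).
Proof.
rewrite /binomz lez_nat /=; case: leqP => //= ab.
by rewrite bin_small.
Qed.

Lemma binomz_neq0 (a b : int) : binomz a b != 0%N -> 0 <= b <= a.
Proof. by rewrite /binomz; case: ifP. Qed.

Lemma st_val_comp n l : l \in compositions s n ->
  st_val (t := uv_pre_term) n (comp_row l)
  = const_term (\prod_(i < s) uvval (c i) ^+ nth 0%N l i) *+ multinomial l.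
Proof.
rewrite mem_compositions => /andP[/eqP ls /eqP ln].
rewrite /st_val /= expr1n mul1r !big_cat !big_cons big_nil !big_map /=.
have -> : lf_eval form_sum n (comp_row l) = n.
  rewrite lf_eval_sum -[in RHS]ln -{2}[l]drop0 sumn_drop ls.
  rewrite (big_morph Posz PoszD (erefl _)).
  by apply: eq_bigr => i _; rewrite mxE mul1n.
rewrite lf_eval_n binomz_nat binn !mulr1 mul1r.
have -> : \prod_(i < s) (binomz (lf_eval (form_tail i) n (comp_row l))
    (lf_eval (form_coord i) n (comp_row l)))%:R = (multinomial l)%:R :> algC.
  rewrite multinomialE natr_prod ls; apply: eq_bigr => i _.
  by rewrite lf_eval_tail // lf_eval_coord mxE binomz_nat.
rewrite mulrCA mulr_natl; congr (_ *+ _).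
have -> : \prod_(i < s) uvval (c i) ^+ nth 0%N l i
    = lmono (\prod_(i < s) (c i).1 ^+ nth 0%N l i) 0
      * uvmono (fun j => \sum_(i < s) (c i).2.1 j * nth 0%N l i)%N
               (fun j => \sum_(i < s) (c i).2.2 j * nth 0%N l i)%N.
  under eq_bigr do rewrite /uvval exprMn lmonoXn mul0rn uvmonoX.
  rewrite big_split /= lmono_prod big1_eq; congr (_ * _).
  rewrite /uvmono exchange_big /=; apply: eq_bigr => j _.
  rewrite big_split /= !prodrXr.
  by congr (_ ^+ _ * _ ^+ _); apply: eq_bigr => i _; rewrite mulnC.
rewrite /const_term lcoef_lmonoM subr0 -/(const_term _) const_term_uvmono.
congr (_ * _); first by apply: eq_bigr => i _; rewrite mxE.
rewrite natr_prod; apply: eq_bigr => j _.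
rewrite !lf_eval_nat binomz_nat; congr ('C(_, _)%:R).
by rewrite -big_split /=; apply: eq_bigr => i _; rewrite mulnDl.
Qed.

(** A nonzero value makes every binomial nonzero, hence [0 <= C_j <= B_j] for each pair; this forces
    [|k| = n] and [k >= 0]. Finiteness of the support follows. *)
Lemma st_val_supp n k :
  st_val (t := uv_pre_term) n k != 0 -> k \in map comp_row (compositions s n).
Proof.
rewrite /st_val mulf_eq0 negb_or => /andP[_].
rewrite prodf_seq_neq0 => /allP binP.
have {}binP b : b \in uv_binoms -> 0 <= lf_eval b.2 n k <= lf_eval b.1 n k.
  by move=> /binP /=; rewrite pnatr_eq0 => /binomz_neq0.
have sum_n : \sum_i k 0 i = n.
  have := binP (form_n, form_sum); have := binP (form_sum, form_n).
  rewrite /uv_binoms !inE !eqxx ?orbT /= => /(_ isT) + /(_ isT).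
  rewrite lf_eval_n lf_eval_sum => /andP[_ nk] /andP[_ kn].
  by apply/eqP; rewrite eq_le kn.
have k_ge0 i : 0 <= k 0 i.
  have := binP (form_tail i, form_coord i).
  rewrite lf_eval_coord /uv_binoms !mem_cat map_f ?mem_index_enum ?orbT //.
  by move=> /(_ isT) /andP[].
apply/mapP; exists [seq absz (k 0 i) | i <- enum 'I_s].
  rewrite mem_compositions size_map size_enum_ord eqxx /= sumnE big_map big_enum.
  rewrite -eqz_nat -sum_n (big_morph Posz PoszD (erefl _)); apply/eqP.
  by apply: eq_bigr => i _; rewrite gez0_abs.
apply/rowP => i; rewrite mxE (nth_map i) ?size_enum_ord // nth_ord_enum.
by rewrite gez0_abs.
Qed.

Lemma uv_term_finite n :
  finite_set [set k | st_val (t := uv_pre_term) n k != 0]%classic.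
Proof.
apply: (@sub_finite_set _ _ [set` map comp_row (compositions s n)]%classic).
  by move=> k /= /st_val_supp.
exact: finite_seq.
Qed.

Definition uv_special_term : special_term :=
  @SpecialTerm uv_pre_term (fun i => c_neq0 (ltn_ord i)) uv_term_finite.

Lemma uv_special_seriesE (F : laurent d) : F = \sum_(i < s) uvval (c i) ->
  moment_series F =1 special_series uv_special_term.
Proof.
move=> -> n; rewrite /moment_series (expr_sum_multinomial _ _ (fun i => uvval (c i))).
rewrite /special_series (fsbigE (map comp_row (compositions s n))) //=; last first.
- by move=> k _ nk; apply/eqP; apply: contraR nk => /st_val_supp.
- rewrite map_inj_in_uniq ?uniq_compositions // => l l'.
  rewrite !mem_compositions => /andP[/eqP ls _] /andP[/eqP l's _] ll'.
  apply: (@eq_from_nth _ 0%N) => [|i]; first by rewrite ls l's.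
  rewrite ls => is_; move/rowP/(_ (Ordinal is_)): ll'.
  by rewrite !mxE => -[].
rewrite /const_term lcoef_sum [RHS]big_map [LHS]big_seq [RHS]big_seq_cond /=.
apply: eq_big => l; first by rewrite in_setT andbT.
move=> lc; rewrite (st_val_comp lc) /const_term.
exact: lcoefMn.
Qed.

End UVSpecialTerm.

(** * The Newton polytope is a standard simplex *)

Section UVNewtonPolytope.
Variable R : realType.

Lemma lf_affineB r (A B : linform r) (w : 'rV[R]_r) :
  lf_affine (A - B) w = lf_affine A w - lf_affine B w.
Proof.
rewrite /lf_affine /= intrB opprD addrACA -sumrB; congr (_ + _).
by apply: eq_bigr => i _; rewrite !mxE intrB mulrBl.
Qed.

(** The two forms [n] and [|k|] give [sum w_i = 1], the coordinate forms give [w >= 0]. Everything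
    else then holds on the simplex, since in the remaining pairs the coefficients are natural
    numbers and those of [B_j] dominate those of [C_j]. *)
Lemma uv_newton_polytope d m (c : nat -> uvterm d)
    (c_neq0 : forall i, (i < m.+1)%N -> (c i).1 != 0) :
  @newton_polytope R (uv_special_term c_neq0) = @std_simplex R m.
Proof.
have affine_n w : lf_affine (form_n m.+1) w = 1 :> R.
  rewrite /lf_affine /= big1 ?addr0 // => i _.
  by rewrite mxE mul0r.
have affine_sum w : lf_affine (form_sum m.+1) w = \sum_i w 0 i :> R.
  by rewrite /lf_affine /= add0r; apply: eq_bigr => i _; rewrite mxE mul1r.
have affine_coord i w : lf_affine (form_coord i) w = w 0 i :> R.
  rewrite /lf_affine /= add0r (bigD1 i) //= mxE !eqxx mul1r.
  by rewrite big1 ?addr0 // => j ji; rewrite mxE eqxx (negbTE ji) mul0r.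
apply/seteqP; split=> w.
  move=> wP; have in_binoms b : b \in uv_binoms m.+1 c ->
      0 <= lf_affine b.2 w /\ 0 <= lf_affine b.1 w - lf_affine b.2 w.
    by move=> /wP[_ b2 b12]; rewrite -lf_affineB.
  split=> [i|].
    have := in_binoms (form_tail i, form_coord i).
    rewrite affine_coord /uv_binoms !mem_cat map_f ?mem_index_enum ?orbT //.
    by move=> /(_ isT) [].
  have := in_binoms (form_n _, form_sum _); have := in_binoms (form_sum _, form_n _).
  rewrite /uv_binoms !inE !eqxx ?orbT /= => /(_ isT)[_ +] /(_ isT)[_ +].
  rewrite affine_n affine_sum !subr_ge0 => n_sum sum_n.
  by apply/eqP; rewrite eq_le sum_n.
move=> [w_ge0 w_sum] b bP.
have affine_ge0 (a : 'I_m.+1 -> nat) : 0 <= lf_affine (0, \row_j (a j)%:R) w.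
  rewrite /lf_affine /= add0r sumr_ge0 // => i _.
  by rewrite mxE mulr_ge0 // natz.
have affine_le (a a' : 'I_m.+1 -> nat) : (forall j, a j <= a' j)%N ->
    0 <= lf_affine (0, \row_j (a' j)%:R) w - lf_affine (0, \row_j (a j)%:R) w.
  move=> aa'; rewrite /lf_affine /= !add0r -sumrB sumr_ge0 // => i _.
  by rewrite !mxE -mulrBl mulr_ge0 // !natz subr_ge0 ler_nat.
suff : [/\ 0 <= lf_affine b.1 w, 0 <= lf_affine b.2 w
  & 0 <= lf_affine b.1 w - lf_affine b.2 w].
  by rewrite -lf_affineB.
have {bP} : b \in uv_binoms m.+1 c := bP.
rewrite /uv_binoms !mem_cat !inE => /orP[/orP[]/eqP->|/orP[]/mapP[i _ ->]] /=.
- by rewrite affine_n affine_sum w_sum subrr.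
- by rewrite affine_n affine_sum w_sum subrr.
- have -> : form_coord i = (0, \row_j (j == i : nat)%:R).
    by congr (_, _); apply/rowP => j; rewrite !mxE eqxx.
  split; [exact: affine_ge0|exact: affine_ge0|apply: affine_le => j].
  by case: eqP => // ->; rewrite leqnn.
split; [exact: affine_ge0|exact: affine_ge0|apply: affine_le => j].
exact: leq_addr.
Qed.

Lemma std_simplex_combinatorial m : combinatorial_simplex (@std_simplex R m).
Proof.
split; last first.
  by exists m, id; split=> //; split=> // F FP; exists F.
exists 1 => w [w_ge0 w_sum] i; rewrite ger0_norm // -w_sum (bigD1 i) //=.
by rewrite lerDl sumr_ge0.
Qed.

End UVNewtonPolytope.

(** The ambient dimension of the polytope varies with [F], so polytopes are compared as dependent
    pairs. *)
Lemma special_terms_exist (R : realType) (d : nat) :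
  exists t : laurent d -> special_term,
    (forall F, moment_series F =1 special_series (t F)) /\
    exists m : laurent d -> nat,
      (forall F, existT (fun r => set 'rV[R]_r) _ (@newton_polytope R (t F))
         = existT (fun r => set 'rV[R]_r) _ (@std_simplex R (m F))) /\
      (forall F F', monomials F = monomials F' -> m F = m F').
Proof.
have [E [EP E_size]] := uv_expansion_exists d.
pose c F i := nth (0, (fun=> 0%N, fun=> 0%N)) (E F) i.
pose m F := (size (E F)).-1.
have c_neq0 F i : (i < (m F).+1)%N -> (c F i).1 != 0.
  by have [[/all_nthP E0 _] sE] := EP F; rewrite prednK //; apply: E0.
exists (fun F => uv_special_term (c_neq0 F)); split.
  move=> F; apply: uv_special_seriesE; have [[_ FE] sE] := EP F.
  by rewrite [LHS]FE (big_nth (0, (fun=> 0%N, fun=> 0%N))) big_mkord prednK.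
exists m; split=> [F|F F' FF']; last by rewrite /m (E_size _ _ FF').
congr existT; exact: uv_newton_polytope.
Qed.

(** * Galois conjugates and denominators of algebraic numbers *)

Local Notation pQtoC := (map_poly (ratr : rat -> algC)).

(** Inside the splitting field [Qr] of the minimal polynomial, [x |-> y] defines a morphism on Q(x);
    it extends to [Qr] by normality and from there to [algC]. *)
Lemma minCpoly_root_aut (x y : algC) :
  root (minCpoly x) y -> exists nu : {rmorphism algC -> algC}, nu x = y.
Proof.
have [p [Dp mon_p] dv_p] := minCpolyP x; move=> py.
have px : root (minCpoly x) x := root_minCpoly x.
have [r Dr] := closed_field_poly_normal (minCpoly x).
rewrite (monicP (minCpoly_monic x)) scale1r in Dr.
have [Qr [QrC [rr Drr genQr]]] := num_field_exists r.
have in_Qr z : root (minCpoly x) z -> exists zz, QrC zz = z.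
  rewrite Dr root_prod_XsubC -Drr => /mapP[zz _ ->]; by exists zz.
have [xx Dx] := in_Qr x px; have [yy Dy] := in_Qr y py.
pose phi := kHomExtend 1 \1 xx yy.
have hom1 : kHom 1 1 (\1%VF : 'End(Qr)) by rewrite kHom1.
(* The minimal polynomial of [xx] comes from a rational polynomial vanishing at [x], so [minCpoly x]
   divides it and [y] is a root. *)
have root_yy : root (map_poly \1%VF (minPoly 1 xx)) yy.
  rewrite -(fmorph_root QrC) Dy -map_poly_comp.
  rewrite (@eq_map_poly _ _ _ QrC) => [|a]; last by rewrite /= id_lfunE.
  set p1 := map_poly _ _.
  have [q1 Dp1] : exists q1, p1 = pQtoC q1.
    have aP i : (minPoly 1 xx)`_i \in 1%VS.
      by apply/polyOverP; apply: minPolyOver.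
    have {aP} a_ i := sig_eqW (vlineP _ _ (aP i)).
    exists (\poly_(i < size (minPoly 1 xx)) sval (a_ i)).
    apply/polyP=> i; rewrite coef_poly coef_map coef_poly /=.
    case: ifP => _; rewrite ?rmorph0 //; case: (a_ i) => a /= ->.
    by rewrite alg_num_field fmorph_rat.
  have : root p1 x by rewrite -Dx fmorph_root root_minPoly.
  rewrite Dp1 dv_p => /dvdpP[r1 ->].
  by rewrite rmorphM rootM /= -Dp py orbT.
have homphi : kHom 1 <<1; xx>> phi by apply: kHomExtendP.
pose pr := map_poly (in_alg Qr) p.
have Qpr : pr \is a polyOver 1%VS.
  by apply/polyOverP=> i; rewrite coef_map memvZ ?memv_line.
have Dpr : map_poly QrC pr = pQtoC p.
  rewrite -map_poly_comp; apply: eq_map_poly => a.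
  by rewrite /= rmorphZ_num rmorph1 mulr1.
have splitQr : splittingFieldFor <<1; xx>>%AS pr fullv.
  apply: splittingFieldForS (sub1v _) (subvf _) _; exists rr => //.
  congr (_ %= _): (eqpxx pr); apply/(map_poly_inj QrC).
  rewrite Dpr -Dp Dr -Drr big_map rmorph_prod /=; apply: eq_bigr => z _.
  by rewrite map_polyXsubC.
have [f hom_f Df] := kHom_extends (sub1v _) homphi Qpr splitQr.
pose fmM := GRing.isMonoidMorphism.Build _ _ f (kHom_monoid_morphism hom_f).
pose fRM : {rmorphism Qr -> Qr} := HB.pack (fun_of_lfun f) fmM.
have [nu Dnu] := extend_algC_subfield_aut QrC fRM.
exists nu; rewrite -Dx -Dnu -[RHS]Dy /=; congr (QrC _).
by rewrite -Df ?memv_adjoin // /phi (kHomExtend_val hom1).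
Qed.

(** Each [nu x] is a root of the minimal polynomial of [x], so the sum of the absolute values of all
    its roots is a bound uniform in [nu]. *)
Lemma aut_norm_bounded (x : algC) : exists C : algC, 0 <= C /\
  forall nu : {rmorphism algC -> algC}, `|nu x| <= C.
Proof.
have [r Dr] := closed_field_poly_normal (minCpoly x).
exists (\sum_(z <- r) `|z|); split=> [|nu]; first exact: sumr_ge0.
have : root (minCpoly x) (nu x) by rewrite -(minCpoly_aut nu) root_minCpoly.
rewrite Dr (monicP (minCpoly_monic x)) scale1r root_prod_XsubC => nu_r.
by rewrite (big_rem _ nu_r) /= lerDl sumr_ge0.
Qed.

(** The leading coefficient [a] of an integral multiple [q] of the minimal polynomial makes [a x]
    integral. *)
Lemma algC_denominator (x : algC) : exists2 D : nat, (0 < D)%N & D%:R * x \in Aint.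
Proof.
have [p [Dp mon_p] _] := minCpolyP x.
have [q [a a0 Dq]] := rat_poly_scale p.
have [k sq] : exists k, size q = k.+1.
  exists (size q).-1; rewrite prednK // lt0n size_poly_eq0; apply: contraTneq mon_p => q0.
  by rewrite Dq q0 rmorph0 scaler0 monicE lead_coef0 eq_sym oner_eq0.
have qk : q`_k = a.
  move/eqP: mon_p; rewrite Dq lead_coefZ lead_coef_map_inj //; last exact: intr_inj.
  rewrite lead_coefE sq => /(canRL (mulKf _)); rewrite invrK mulr1 => qa.
  by apply: (intr_inj (R := rat)); rewrite qa // invr_eq0 intr_eq0.
have qx : \sum_(i < k.+1) (q`_i)%:~R * x ^+ i = 0 :> algC.
  have := root_minCpoly x; rewrite Dp Dq linearZ /= rootZ; last first.
    by rewrite fmorph_eq0 invr_eq0 intr_eq0.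
  have size_q : size (map_poly (ratr \o intr : int -> algC) q) = size q.
    apply: size_map_inj_poly; first by move=> i j /= /fmorph_inj /intr_inj.
    by rewrite /= rmorph0.
  rewrite -map_poly_comp /root horner_coef size_q.
  rewrite sq => /eqP {2}<-; apply: eq_bigr => i _.
  by rewrite coef_map_id0 //= ratr_int.
(* This is [a^(k-1) q(X/a)], a monic integral polynomial vanishing at [a x]. *)
pose P : {poly algC} :=
  'X^k + \poly_(i < k) ((q`_i)%:~R * a%:~R ^+ (k.-1 - i)).
have aAint : a%:~R * x \in Aint.
  apply: (@root_monic_Aint P).
  - rewrite /root /P hornerD hornerXn horner_poly.
    have k_gt0 : (0 < k)%N.
      rewrite lt0n; apply/eqP => k0; have qk0 := qk; rewrite k0 in qk0.
      by move/eqP: qx; rewrite k0 big_ord1 expr0 mulr1 qk0 intr_eq0 (negbTE a0).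
    apply/eqP; rewrite -[RHS](mulr0 (a%:~R ^+ k.-1)) -[in RHS]qx mulr_sumr.
    rewrite big_ord_recr /= addrC; congr (_ + _).
      by rewrite qk mulrA -exprSr prednK // exprMn.
    apply: eq_bigr => i _; have ik : (i <= k.-1)%N by rewrite -ltnS prednK.
    rewrite exprMn -[in RHS](subnK ik) exprD; set e := (k.-1 - i)%N; ring.
  - rewrite monicE /P lead_coefDl ?lead_coefXn // size_polyXn ltnS.
    exact: size_poly.
  - apply/polyOverP => i; rewrite coefD coefXn rpredD ?rpred_nat //.
    rewrite coef_poly; case: ifP => _; last exact: rpred0.
    by rewrite rpredM ?rpredX ?intr_int.
exists `|a|%N; first by rewrite absz_gt0.
have [a_ge0|a_le0] := leP 0 a.
  by rewrite -[_%:R]/(`|a|%N%:~R) gez0_abs.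
have -> : `|a|%N%:R = - a%:~R :> algC.
  by rewrite -[_%:R]/(`|a|%N%:~R) ltz0_abs // rmorphN.
by rewrite mulNr rpredN.
Qed.

Lemma algC_common_denominator (s : seq algC) :
  exists2 D : nat, (0 < D)%N & {in s, forall x, D%:R * x \in Aint}.
Proof.
elim: s => [|x s [D D0 DP]]; first by exists 1%N.
have [E E0 EP] := algC_denominator x.
exists (E * D)%N => [|y]; first by rewrite muln_gt0 E0.
rewrite inE natrM => /predU1P[->|/DP yA].
  by rewrite mulrAC mulrC rpredM // Aint_Cnat ?natr_nat.
by rewrite -mulrA rpredM // Aint_Cnat ?natr_nat.
Qed.

(** * Growth of the conjugates and denominators of the moments *)

Lemma ler_sum_fsubset (K : choiceType) (A B : {fset K}) (g : K -> algC) :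
  (forall x, 0 <= g x) -> (A `<=` B)%fset ->
  \sum_(x <- A) g x <= \sum_(x <- B) g x.
Proof.
move=> g0 AB; rewrite [leRHS](big_fsetID _ (mem A)) /=.
have -> : [fset x in B | x \in A]%fset = A.
  apply/fsetP => x; rewrite !inE /=; apply: andb_idl => xA.
  exact: (fsubsetP AB).
by rewrite lerDl sumr_ge0.
Qed.

Section AutNorm.
Variables (d : nat) (nu : {rmorphism algC -> algC}).
Implicit Types f g : laurent d.

(* Bounding the sums over all finite sets of exponents bounds the l^1 norm of the
   conjugate of f by nu without mentioning its support. *)
Definition norm_le f (C : algC) : Prop :=
  forall A : {fset 'rV[int]_d}, \sum_(m <- A) `|nu (lcoef f m)| <= C.

Lemma norm_le_supp f C : \sum_(m <- finsupp f) `|nu (lcoef f m)| <= C ->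
  norm_le f C.
Proof.
move=> fC A; apply: le_trans fC.
rewrite -(@big_fset_incl _ _ _ _ (A `&` finsupp f)%fset); first last.
- move=> x xA; rewrite inE xA /= => xf.
  by rewrite lcoef_out // rmorph0 normr0.
- exact: fsubsetIl.
by apply: ler_sum_fsubset; rewrite ?fsubsetIr.
Qed.

Lemma norm_leM f g C C' : norm_le f C -> norm_le g C' -> norm_le (f * g) (C * C').
Proof.
move=> fC gC A; have C'0 : 0 <= C' by have := gC fset0; rewrite big_seq_fset0.
apply: (@le_trans _ _ (\sum_(m <- A) \sum_(x <- finsupp f)
    `|nu (lcoef f x)| * `|nu (lcoef g (m - x))|)).
  apply: ler_sum => m _; rewrite lcoefM rmorph_sum (le_trans (ler_norm_sum _ _ _)) //.
  by apply: ler_sum => x _; rewrite rmorphM normrM.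
rewrite exchange_big /=; apply: le_trans (ler_wpM2r C'0 (fC (finsupp f))).
rewrite mulr_suml; apply: ler_sum => x _; rewrite -mulr_sumr ler_wpM2l //.
apply: le_trans (gC [fset m - x | m in A]%fset).
by rewrite big_imfset //= => y z _ _ /addIr.
Qed.

Lemma norm_leD f g C C' : norm_le f C -> norm_le g C' -> norm_le (f + g) (C + C').
Proof.
move=> fC gC A; apply: le_trans (lerD (fC A) (gC A)).
rewrite -big_split /=; apply: ler_sum => m _.
by rewrite lcoefD rmorphD ler_normD.
Qed.

Lemma norm_le_sum I (r : seq I) (F : I -> laurent d) C :
  (forall i, norm_le (F i) C) -> norm_le (\sum_(i <- r) F i) ((size r)%:R * C).
Proof.
move=> FC; elim: r => [|i r IHr].
  rewrite big_nil mul0r => A; rewrite big1 // => m _.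
  by rewrite lcoef0 rmorph0 normr0.
by rewrite big_cons /= -natr1 mulrDl mul1r addrC; apply: norm_leD.
Qed.

(** The entries of the identity matrix have this form; the induction on matrix powers starts
    here. *)
Lemma norm_le_nat (b : bool) : norm_le (b%:R) 1.
Proof.
have -> : b%:R = lmono b%:R 0 :> laurent d.
  case: b; first by rewrite lmono1.
  by apply: lcoefP => m; rewrite lcoef_lmono lcoef0 mul0rn.
apply: norm_le_supp; rewrite -[leRHS]/(1%:R) -[1%N]/(true : nat).
apply: (@le_trans _ _ (\sum_(m <- [fset 0 : 'rV[int]_d]%fset)
   `|nu (lcoef (lmono b%:R 0) m)|)).
  apply: ler_sum_fsubset => //; exact: finsupp_sub.
rewrite big_seq_fset1 lcoef_lmono eqxx rmorph_nat.
by case: b; rewrite ?normr1 ?normr0 ?ler01.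
Qed.

Lemma norm_le_mxX N (F : 'M[laurent d]_N) B n i j :
  (forall i j, norm_le (F i j) B) -> norm_le ((F ^+ n) i j) ((N%:R * B) ^+ n).
Proof.
move=> FB; elim: n i j => [|n IHn] i j.
  by rewrite expr0 mxE; apply: norm_le_nat.
rewrite exprS mxE [X in norm_le _ X]exprS -mulrA.
have := @norm_le_sum _ (index_enum 'I_N) (fun k => F i k * (F ^+ n) k j)
  (B * (N%:R * B) ^+ n) (fun k => norm_leM (FB i k) (IHn k j)).
by rewrite [index_enum _]unlock -enumT size_enum_ord.
Qed.

End AutNorm.

Lemma norm_le_exists d N (F : 'M[laurent d]_N) : exists2 B : algC, 0 <= B
  & forall (nu : {rmorphism algC -> algC}) i j, norm_le nu (F i j) B.
Proof.
have [b bP] := choice aut_norm_bounded.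
exists (\sum_i \sum_j \sum_(m <- finsupp (F i j)) b (lcoef (F i j) m)).
  do 3!(apply: sumr_ge0 => ? _); exact: (bP _).1.
have b_ge0 i j : 0 <= \sum_(m <- finsupp (F i j)) b (lcoef (F i j) m).
  by apply: sumr_ge0 => ? _; exact: (bP _).1.
move=> nu i j; apply: norm_le_supp.
rewrite (bigD1 i) //= (bigD1 j) //= -addrA.
apply: (@le_trans _ _ (\sum_(m <- finsupp (F i j)) b (lcoef (F i j) m))).
  by apply: ler_sum => m _; exact: (bP _).2.
by rewrite lerDl addr_ge0 // !sumr_ge0 // => k _; rewrite sumr_ge0.
Qed.

(** The coefficients in [F ^+ n] are sums of [n]-fold products of coefficients of [F], so the [n]-th
    power of a common denominator of the latter clears them. *)
Lemma mx_denominator d N (F : 'M[laurent d]_N) : exists2 D : nat, (0 < D)%N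
  & forall n i j m, D%:R ^+ n * lcoef ((F ^+ n) i j) m \in Aint.
Proof.
pose s := [seq lcoef (F p.1 p.2) m
  | p <- enum {: 'I_N * 'I_N}, m <- finsupp (F p.1 p.2)].
have [D D0 DP] := algC_common_denominator s.
have DF i j m : D%:R * lcoef (F i j) m \in Aint.
  have [mF|mF] := boolP (m \in finsupp (F i j)); last first.
    by rewrite lcoef_out // mulr0 rpred0.
  apply: DP; apply/allpairsPdep; exists (i, j), m; split=> //.
  by rewrite mem_enum.
exists D => // n; elim: n => [|n IHn] i j m.
  rewrite expr0 mul1r mxE; case: (i == j).
    by rewrite lcoef1 Aint_Cnat ?natr_nat.
  by rewrite lcoef0 rpred0.
rewrite !exprS mxE lcoef_sum mulr_sumr rpred_sum // => k _.
rewrite lcoefM mulr_sumr rpred_sum // => x _.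
by rewrite mulrACA rpredM.
Qed.

Lemma moment_series_mxE d N (F : 'M[laurent d]_N) n :
  moment_series_mx F n = \sum_i lcoef ((F ^+ n) i i) 0.
Proof. by rewrite /moment_series_mx /const_term /mxtrace lcoef_sum. Qed.

Lemma moment_series_mx_growth d N (F : 'M[laurent d]_N) :
  exists C : algC, 0 < C /\ forall n, (0 < n)%N ->
    (forall y, galois_conjugate (moment_series_mx F n) y -> `|y| <= C ^+ n) /\
    (exists D, common_denominator (moment_series_mx F) n D /\ D%:R <= C ^+ n).
Proof.
have [B B0 FB] := norm_le_exists F.
have [D0 D0_gt0 D0P] := mx_denominator F.
have NB0 : 0 <= N%:R * B by rewrite mulr_ge0.
(* The first summand absorbs the factor [N] of the trace, since [N <= (N + 1)^n] for [n >= 1]; the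
   second bounds the denominators. *)
exists (N.+1%:R * (N%:R * B + 1) + D0%:R); split.
  by rewrite ltr_wpDl ?ltr0n // mulr_ge0 ?addr_ge0.
set C := _ + D0%:R => n n_gt0.
have C1 : N.+1%:R * (N%:R * B + 1) <= C by rewrite lerDl.
have C2 : D0%:R <= C by rewrite lerDr mulr_ge0 ?addr_ge0.
split=> [y /minCpoly_root_aut[nu <-]|].
  apply: (@le_trans _ _ (N%:R * (N%:R * B) ^+ n)).
    rewrite moment_series_mxE rmorph_sum (le_trans (ler_norm_sum _ _ _)) //.
    apply: (@le_trans _ _ (\sum_(i < N) (N%:R * B) ^+ n)); last first.
      by rewrite sumr_const card_ord [leRHS]mulr_natl.
    apply: ler_sum => i _.
    by have := norm_le_mxX n i i (FB nu) [fset 0]%fset; rewrite big_seq_fset1.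
  apply: (@le_trans _ _ ((N.+1%:R * (N%:R * B + 1)) ^+ n)); last first.
    by rewrite lerXn2r // nnegrE ?(le_trans _ C1) ?mulr_ge0 ?addr_ge0.
  rewrite [leRHS]exprMn ler_pM ?exprn_ge0 //; last first.
    by rewrite lerXn2r ?nnegrE ?addr_ge0 // lerDl.
  apply: (@le_trans _ _ N.+1%:R); first by rewrite ler_nat.
  by rewrite -[leLHS]expr1 ler_weXn2l // ler1n.
have D0_clears : clears_denominators (moment_series_mx F) n (D0 ^ n).
  split=> [|i i_n]; first by rewrite expn_gt0 D0_gt0.
  rewrite -(subnK i_n) expnD natrM !natrX -mulrA rpredM //.
    by rewrite rpredX // Aint_Cnat ?natr_nat.
  by rewrite moment_series_mxE mulr_sumr rpred_sum.
pose P D := `[< clears_denominators (moment_series_mx F) n D >].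
have exP : exists D, P D by exists (D0 ^ n)%N; apply/asboolP.
have [D /asboolP DP D_min] := ex_minnP exP.
exists D; split; first by split=> // D' D'P; apply: D_min; apply/asboolP.
apply: (@le_trans _ _ ((D0 ^ n)%N%:R)).
  by rewrite ler_nat; apply: D_min; apply/asboolP.
by rewrite natrX lerXn2r ?nnegrE //; apply: le_trans C2.
Qed.

(** * Polynomials and derivations acting on power series *)

Section SeriesAction.
Variable A : comNzRingType.
Implicit Types (p q : {poly A}) (h g : nat -> A).

(* A sequence nat -> A stands for a formal power series over A in one variable z. *)
Definition pact p h : nat -> A := fun n => \sum_(j < n.+1) p`_j * h (n - j)%N.

Definition sderiv h : nat -> A := fun n => n.+1%:R * h n.+1.

(** Coefficients up to [K] only see a truncation of the series, which transfers polynomial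
    identities such as associativity and the Leibniz rule. *)
Lemma pact_trunc p h n K : (n <= K)%N ->
  pact p h n = (p * \poly_(i < K.+1) h i)`_n.
Proof.
move=> nK; rewrite coefM; apply: eq_bigr => j _.
by rewrite coef_poly ltnS (leq_trans (leq_subr _ _) nK).
Qed.

Lemma pactM p q h : pact (p * q) h = pact p (pact q h).
Proof.
apply: funext => n; rewrite (pact_trunc _ _ (leqnn n)) -mulrA coefM.
by apply: eq_bigr => j _; rewrite (@pact_trunc _ _ _ n) ?leq_subr.
Qed.

Lemma pact_coef p q n : pact p (fun i => q`_i) n = (p * q)`_n.
Proof. by rewrite coefM. Qed.

Lemma eq_pact p h g : h =1 g -> pact p h =1 pact p g.
Proof. by move=> hg n; apply: eq_bigr => j _; rewrite hg. Qed.

Lemma pactBr p h g n : pact p (fun i => h i - g i) n = pact p h n - pact p g n.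
Proof. by rewrite -sumrB; apply: eq_bigr => j _; rewrite mulrBr. Qed.

Lemma pactMn p h k n : pact (p *+ k) h n = pact p h n *+ k.
Proof. by rewrite -sumrMnl; apply: eq_bigr => j _; rewrite coefMn mulrnAl. Qed.

Lemma pactXn k h n : pact 'X^k h n = if (k <= n)%N then h (n - k)%N else 0.
Proof.
case: leqP => kn.
  rewrite /pact (bigD1 (Ordinal (kn : (k < n.+1)%N))) //= coefXn eqxx mul1r.
  rewrite big1 ?addr0 // => j; rewrite -val_eqE /= => /negbTE jk.
  by rewrite coefXn jk mul0r.
rewrite /pact big1 // => j _; rewrite coefXn.
by rewrite ltn_eqF ?mul0r // (leq_trans (ltn_ord j)).
Qed.

(** With constant coefficient 1, the equation for index [n] expresses [h n] through earlier
    values. *)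
Lemma pact_eq0 p h : p`_0 = 1 -> (forall n, pact p h n = 0) -> forall n, h n = 0.
Proof.
move=> p0 ph n; elim/ltn_ind: n => n IHn.
have := ph n; rewrite /pact big_ord_recl p0 mul1r subn0 big1 ?addr0 // => j _.
by rewrite IHn ?mulr0 //= /bump /=; have := ltn_ord j; lia.
Qed.

Lemma sderiv_pact p h n :
  sderiv (pact p h) n = pact p^`() h n + pact p (sderiv h) n.
Proof.
rewrite /sderiv (pact_trunc _ _ (leqnn n.+1)).
rewrite mulr_natl -coef_deriv derivM coefD.
rewrite (@pact_trunc _ _ _ n.+1) //; congr (_ + _).
rewrite coefM; apply: eq_bigr => j _; congr (_ * _).
rewrite coef_deriv coef_poly ltnS ltnS leq_subr mulr_natl.
by [].
Qed.

(** A derivation given compatibly on polynomials and on series; it covers d/dz and the d/dx_i at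
    once. *)
Definition derivation (dp : {poly A} -> {poly A}) (ds : (nat -> A) -> nat -> A) :=
  [/\ forall p q, dp (p * q) = dp p * q + p * dp q,
      forall p h n, ds (pact p h) n = pact (dp p) h n + pact p (ds h) n,
      forall p n, ds (fun i => p`_i) n = (dp p)`_n
    & forall h g, h =1 g -> ds h =1 ds g].

Lemma derivation_sderiv : derivation (@deriv A) sderiv.
Proof.
split=> [p q|p h n|p n|h g hg n]; first exact: derivM.
- exact: sderiv_pact.
- by rewrite coef_deriv /sderiv mulr_natl.
- by rewrite /sderiv hg.
Qed.

Lemma derivationX dp ds p w : derivation dp ds ->
  p * dp (p ^+ w) = (dp p * p ^+ w) *+ w.
Proof.
case=> dM _ _ _; elim: w => [|w IHw].
  rewrite expr0 mulr0n; have := dM 1 1; rewrite !mulr1 mul1r.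
  by move/eqP; rewrite -subr_eq0 opprD addNKr oppr_eq0 => /eqP->; rewrite mulr0.
by rewrite exprS dM mulrDr IHw mulrnAr -mulrS mulrCA.
Qed.

(** The quotient rule for [g = q / p^w]. *)
Lemma derivation_step dp ds p w g q : derivation dp ds ->
  (forall n, pact (p ^+ w) g n = q`_n) ->
  forall n, pact (p ^+ w.+1) (ds g) n = (p * dp q - (dp p * q) *+ w)`_n.
Proof.
move=> dD gq n; have [dM dpact dcoef deq] := dD.
rewrite exprS pactM.
have dg i : pact (p ^+ w) (ds g) i = (dp q)`_i - pact (dp (p ^+ w)) g i.
  by rewrite -dcoef -(deq _ _ gq) dpact addrAC subrr add0r.
rewrite (eq_pact _ dg) pactBr pact_coef -pactM (derivationX _ _ dD).
by rewrite pactMn pactM (eq_pact _ gq) pact_coef coefB coefMn.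
Qed.

Lemma derivation_map (D : A -> A) : zmod_morphism D ->
  (forall x y, D (x * y) = D x * y + x * D y) ->
  derivation (map_poly D) (fun h n => D (h n)).
Proof.
move=> DB DM; pose DB' := GRing.isZmodMorphism.Build _ _ D DB.
pose D' : {additive A -> A} := HB.pack D DB'.
have D0 : D 0 = 0 := raddf0 D'.
have coefD' p i : (map_poly D p)`_i = D p`_i by rewrite coef_map_id0.
have Dsum n (F : 'I_n -> A) : D (\sum_i F i) = \sum_i D (F i) := raddf_sum D' _ _ _.
split=> [p q|p h n|p n|h g hg n] /=.
- apply/polyP => i; rewrite coefD' coefD !coefM Dsum -big_split /=.
  by apply: eq_bigr => j _; rewrite DM !coefD'.
- rewrite /pact Dsum -big_split /=.
  by apply: eq_bigr => j _; rewrite DM coefD'.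
- by rewrite coefD'.
- by rewrite hg.
Qed.

End SeriesAction.

(** * Partial derivatives in x and sizes of supports *)

Section LaurentDerivations.
Variable d : nat.
Implicit Types (f g : laurent d) (m : 'rV[int]_d) (i j : 'I_d).

Definition lderiv i f : laurent d :=
  [fsfun m in [fset x - evec i | x in finsupp f]%fset =>
    (m 0 i + 1)%:~R * lcoef f (m + evec i)].

Lemma lcoef_lderiv i f m :
  lcoef (lderiv i f) m = (m 0 i + 1)%:~R * lcoef f (m + evec i).
Proof.
rewrite {1}/lcoef fsfunE; case: ifPn => // nm; rewrite [lcoef f _]lcoef_out ?mulr0 //.
apply: contra nm => mf; apply/imfsetP; exists (m + evec i) => //.
by rewrite addrK.
Qed.

Lemma lderiv_zmod_morphism i : zmod_morphism (lderiv i).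
Proof.
by move=> f g; apply: lcoefP => m; rewrite !(lcoef_lderiv, lcoefD, lcoefN) mulrBr.
Qed.

Lemma lderivM i f g : lderiv i (f * g) = lderiv i f * g + f * lderiv i g.
Proof.
apply: lcoefP => m; rewrite lcoefD lcoef_lderiv.
pose A := [fset x - evec i | x in finsupp f]%fset.
have -> : lcoef (lderiv i f * g) m
    = \sum_(x <- A) lcoef (lderiv i f) x * lcoef g (m - x).
  by apply: lcoef_mul_sub; apply/fsubsetP; exact: finsupp_sub.
rewrite !lcoefM.
rewrite big_imfset /=; last by move=> x y _ _ /addIr.
rewrite mulr_sumr -big_split /=; apply: eq_bigr => x _.
rewrite !lcoef_lderiv subrK opprB addrA [m + evec i]addrC.
rewrite [m - x + _]addrC addrA !mxE !eqxx !rmorphD !rmorphN /=.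
set G := lcoef g _; set X := lcoef f x; ring.
Qed.

(** The integer factor vanishes exactly for [-k <= m_i <= -1]; this later decides which derivatives
    survive. *)
Lemma lcoef_iter_lderiv i k f m : lcoef (iter k (lderiv i) f) m
  = (\prod_(t < k) (m 0 i + t.+1%:Z))%:~R * lcoef f (m + evec i *+ k).
Proof.
elim: k m => [|k IHk] m; first by rewrite big_ord0 mul1r addr0.
rewrite iterS lcoef_lderiv IHk big_ord_recl rmorphM /= -mulrA.
congr (_ * (_%:~R * lcoef f _)); last by rewrite mulrS addrA.
apply: eq_bigr => t _; rewrite !mxE !eqxx /= /bump /=; lia.
Qed.

Definition lderivs (k : 'I_d -> nat) (s : seq 'I_d) f : laurent d :=
  foldr (fun i => iter (k i) (lderiv i)) f s.

Lemma lcoef_lderivs k s f m : uniq s -> lcoef (lderivs k s f) m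
  = (\prod_(i <- s) \prod_(t < k i) (m 0%R i + t.+1%:Z))%:~R
    * lcoef f (m + \sum_(i <- s) evec i *+ k i).
Proof.
elim: s m => [|i s IHs] m /=; first by rewrite !big_nil mul1r addr0.
move=> /andP[is_ us]; rewrite lcoef_iter_lderiv IHs // !big_cons mulrA -rmorphM addrA.
congr ((_ * _)%:~R * _); rewrite big_seq [RHS]big_seq; apply: eq_bigr => j js.
have ji : (j == i) = false by apply: contraNF is_ => /eqP<-.
by apply: eq_bigr => t _; rewrite !mxE mulmxnE mxE eqxx ji /= mul0rn addr0.
Qed.

(** One bound controls both the degree in z and the exponents in x, so numerators of bounded size
    lie in one finite-dimensional space. *)
Definition box (D : nat) (p : {poly laurent d}) : Prop :=
  forall n m, lcoef p`_n m != 0 -> (n <= D)%N /\ forall j, (absz (m 0%R j) <= D)%N.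

Lemma box_le D D' p : (D <= D')%N -> box D p -> box D' p.
Proof.
move=> DD' pD n m /pD[nD mD]; split=> [|j]; first exact: leq_trans DD'.
exact: leq_trans DD'.
Qed.

Lemma box_exists p : exists D, box D p.
Proof.
exists (\sum_(n < size p) (n + \sum_(m <- finsupp (p`_n)%R) \sum_j absz (m 0%R j)))%N.
move=> n m pnm.
have np : (n < size p)%N.
  by rewrite ltnNge; apply: contra pnm => np; rewrite nth_default // lcoef0.
have mp : m \in finsupp p`_n by rewrite mem_finsupp.
rewrite (bigD1 (Ordinal np)) //= (big_fsetD1 m) //=; split=> [|j].
  by rewrite -addnA leq_addr.
by rewrite (bigD1 j) //=; lia.
Qed.

Lemma boxM D D' p q : box D p -> box D' q -> box (D + D') (p * q).
Proof.
move=> pD qD n m; rewrite coefM lcoef_sum => /eqP pq0.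
have [k /eqP] : exists k : 'I_n.+1, lcoef (p`_k * q`_(n - k)) m <> 0.
  apply: contrapT => /forallNP H; apply: pq0; apply: big1 => k _.
  by apply: contrapT; exact: H.
rewrite lcoefM => /eqP pqk0.
have [x /eqP] : exists x, lcoef p`_k x * lcoef q`_(n - k) (m - x) <> 0.
  apply: contrapT => /forallNP H; apply: pqk0; apply: big1 => x _.
  by apply: contrapT; exact: H.
rewrite mulf_eq0 negb_or => /andP[/pD[kD xD] /qD[nkD mxD]].
have kn := ltn_ord k; split; first by lia.
move=> j; move: (xD j) (mxD j); rewrite !mxE.
by move: (m 0 j) (x 0 j) => a b; lia.
Qed.

Lemma boxD D p q : box D p -> box D q -> box D (p + q).
Proof.
move=> pD qD n m; rewrite coefD lcoefD => pq0.
have [p0|/pD //] := eqVneq (lcoef p`_n m) 0.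
by apply: qD; rewrite p0 add0r in pq0.
Qed.

Lemma boxMn D p k : box D p -> box D (p *+ k).
Proof.
move=> pD n m; rewrite coefMn lcoefMn => pk0; apply: pD.
by apply: contraNneq pk0 => ->; rewrite mul0rn.
Qed.

Lemma boxN D p : box D p -> box D (- p).
Proof. by move=> pD n m; rewrite coefN lcoefN oppr_eq0 => /pD. Qed.

Lemma boxXn k : box k 'X^k.
Proof.
move=> n m; rewrite coefXn; case: (eqVneq n k) => [->|_]; last by rewrite lcoef0 eqxx.
rewrite lcoef1; case: (eqVneq m 0) => [->|_]; last by rewrite eqxx.
by split=> // j; rewrite mxE.
Qed.

Lemma box_exp D p k : box D p -> box (k * D) (p ^+ k).
Proof.
move=> pD; elim: k => [|k IHk]; first by rewrite mul0n expr0 -(expr0 'X); exact: boxXn.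
by rewrite exprS mulSn; apply: boxM.
Qed.

(** The degree in z drops, but the bound [D.+1] matches that of [box_lderiv], where a negative
    exponent can grow in absolute value; both derivations can thus be treated alike. *)
Lemma box_deriv D p : box D p -> box D.+1 p^`().
Proof.
move=> pD n m; rewrite coef_deriv lcoefMn => pn.
have [nD mD] : (n.+1 <= D)%N /\ forall j, (absz (m 0%R j) <= D)%N.
  by apply: pD; apply: contraNneq pn => ->; rewrite mul0rn.
by split=> [|j]; [lia|rewrite ltnW ?ltnS].
Qed.

Lemma lderiv0 i : lderiv i 0 = 0.
Proof. by apply: lcoefP => m; rewrite lcoef_lderiv !lcoef0 mulr0. Qed.

Lemma box_lderiv D p i : box D p -> box D.+1 (map_poly (lderiv i) p).
Proof.
move=> pD n m; rewrite coef_map_id0 ?lderiv0 // lcoef_lderiv mulf_eq0 negb_or.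
move=> /andP[_ /pD[nD mD]]; split=> [|j]; first by rewrite ltnW.
move: (mD j); rewrite !mxE eqxx /=; by move: (m 0 j) => a; case: (j == i) => /=; lia.
Qed.

End LaurentDerivations.

(** * Linear algebra and counting for the dimension argument *)

Lemma linear_relation (K : fieldType) (I J : finType) (M : I -> J -> K) :
  (#|J| < #|I|)%N ->
  exists2 c : I -> K, (exists i, c i != 0) & forall j, \sum_i c i * M i j = 0.
Proof.
move=> JI; pose A := \matrix_(i < #|I|, j < #|J|) M (enum_val i) (enum_val j).
have : kermx A != 0.
  rewrite -mxrank_eq0 mxrank_ker subn_eq0 -ltnNge.
  by rewrite (leq_ltn_trans (rank_leq_col A)).
case/rowV0Pn => v /sub_kermxP vA v0.
exists (fun i => v 0 (enum_rank i)).
  have [i vi] : exists i, v 0 i != 0.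
    apply/existsP; apply: contraR v0; rewrite negb_exists => /forallP v0.
    by apply/eqP/rowP => i; rewrite mxE; apply/eqP/negPn/v0.
  by exists (enum_val i); rewrite enum_valK.
move=> j; move/rowP/(_ (enum_rank j)): vA; rewrite !mxE => vA.
rewrite -[RHS]vA (reindex (@enum_val I I)) /=; last exact: onW_bij (@enum_val_bij I).
by apply: eq_bigr => i _; rewrite enum_valK mxE enum_rankK.
Qed.

(** The left side counts the monomials in a box of size [K * L], the right side the operators with
    all exponents below [L]. *)
Lemma box_count_lt (d K : nat) : (0 < K)%N -> exists2 L : nat, (0 < L)%N
  & ((K * L).+1 * (2 * (K * L)).+1 ^ d < L * L * L ^ d)%N.
(* The left side is at most [(3KL)^(d+1)], and [L > (3K)^(d+1)] makes this smaller than
   [L^(d+2)]. *)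
Proof.
move=> K0; exists ((3 * K) ^ d.+1).+1 => //; set L := ((3 * K) ^ d.+1).+1.
have KL0 : (0 < K * L)%N by rewrite muln_gt0 K0.
apply: (@leq_ltn_trans ((3 * (K * L)) ^ d.+1)%N).
  move: (K * L)%N KL0 => X X0; rewrite [leqRHS]expnS; apply: leq_mul; first by lia.
  have [->//|d0] := posnP d.
  by rewrite leq_exp2r //; lia.
rewrite mulnA expnMn -mulnA -expnS ltn_pmul2r //.
by rewrite expn_gt0.
Qed.

Lemma pact_sum (A : comNzRingType) (I : finType) (p : {poly A}) (c : I -> A)
    (g : I -> nat -> A) n :
  pact p (fun k => \sum_i c i * g i k) n = \sum_i c i * pact p (g i) n.
Proof.
rewrite /pact; under eq_bigr do rewrite mulr_sumr.
rewrite exchange_big /=; apply: eq_bigr => i _; rewrite mulr_sumr.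
by apply: eq_bigr => j _; rewrite mulrCA.
Qed.

Lemma pact_suml (A : comNzRingType) (I : finType) (p : I -> {poly A}) (c : I -> A)
    (g : nat -> A) n :
  pact (\sum_i c i *: p i) g n = \sum_i c i * pact (p i) g n.
Proof.
rewrite /pact; under eq_bigr do rewrite coef_sum mulr_suml.
rewrite exchange_big /=; apply: eq_bigr => i _; rewrite mulr_sumr.
by apply: eq_bigr => j _; rewrite coefZ mulrA.
Qed.

(** * Rational series with denominator a power of [P] *)

Section RationalSeries.
Variables (d : nat) (P : {poly laurent d}) (c : nat).
Hypothesis Pc : box c P.
Implicit Types (g h : nat -> laurent d) (p q : {poly laurent d}).

(** This says [g = q / P^w], with [D] recording the size of the numerator. *)
Definition rational_in w D g : Prop :=
  exists2 q, box D q & forall n, pact (P ^+ w) g n = q`_n.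

(** By the quotient rule the numerator grows by [c] from the factor [P] and by 1 from the
    derivation. *)
Lemma rational_in_derivation dp ds w D g : derivation dp ds ->
  (forall D p, box D p -> box D.+1 (dp p)) ->
  rational_in w D g -> rational_in w.+1 (D + c.+1) (ds g).
Proof.
move=> dD dbox [q qD gq]; exists (P * dp q - (dp P * q) *+ w); last first.
  exact: derivation_step.
apply: boxD.
  by rewrite addnC addSnnS; apply: boxM; [exact: Pc|exact: dbox].
by apply/boxN/boxMn; rewrite addnC; apply: boxM; [exact: dbox|exact: qD].
Qed.

Lemma rational_in_iter dp ds w D g k : derivation dp ds ->
  (forall D p, box D p -> box D.+1 (dp p)) ->
  rational_in w D g -> rational_in (w + k) (D + k * c.+1) (iter k ds g).
Proof.
move=> dD dbox gD; elim: k => [|k IHk]; first by rewrite !addn0.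
by rewrite addnS mulSnr addnA iterS; exact: rational_in_derivation dD dbox IHk.
Qed.

Lemma rational_in_lderivs (k : 'I_d -> nat) s w D g : rational_in w D g ->
  rational_in (w + \sum_(i <- s) k i) (D + (\sum_(i <- s) k i) * c.+1)
    (fun n => lderivs k s (g n)).
Proof.
move=> gD; elim: s => [|i s IHs]; first by rewrite !big_nil !addn0.
rewrite big_cons [(k i + _)%N]addnC mulnDl !addnA /=.
have -> : (fun n => iter (k i) (lderiv i) (lderivs k s (g n)))
    = iter (k i) (fun h n => lderiv i (h n)) (fun n => lderivs k s (g n)).
  by elim: (k i) => //= j <-.
apply: rational_in_iter IHs.
  exact: derivation_map (@lderiv_zmod_morphism d i) (@lderivM d i).
by move=> ? ?; exact: box_lderiv.
Qed.

Lemma rational_in_Xn w D g a :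
  rational_in w D g -> rational_in w (D + a) (pact 'X^a g).
Proof.
move=> [q qD gq]; exists ('X^a * q).
  by rewrite addnC; apply: boxM => //; exact: boxXn.
move=> n; rewrite -pactM mulrC pactM.
by rewrite (eq_pact _ gq) pact_coef.
Qed.

Lemma rational_in_pad w W D g : (w <= W)%N ->
  rational_in w D g -> rational_in W (D + (W - w) * c) g.
Proof.
move=> wW [q qD gq]; exists (P ^+ (W - w) * q).
  by rewrite addnC; apply: boxM => //; exact: box_exp.
by move=> n; rewrite -{1}(subnK wW) exprD pactM (eq_pact _ gq) pact_coef.
Qed.

(** All operators with exponents below [L] share one denominator, and the numerator bound is linear
    in [L], as the dimension count requires. *)
Lemma rational_in_operator D0 h L a b (k : 'I_d -> nat) :
  rational_in 1 D0 h -> (a < L)%N -> (b < L)%N -> (forall i, (k i < L)%N) ->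
  rational_in (1 + d.+1 * L) ((D0 + c.+1 * d.+1 + 1) * L)
    (pact 'X^a (iter b (@sderiv _) (fun n => lderivs k (enum 'I_d) (h n)))).
Proof.
move=> hD aL bL kL; set S := (\sum_(i <- enum 'I_d) k i)%N.
have SL : (S <= d * L)%N.
  apply: (@leq_trans (\sum_(i < d) L)%N); last by rewrite sum_nat_const card_ord.
  by rewrite /S big_enum /=; apply: leq_sum => i _; exact: ltnW.
have := rational_in_lderivs k (enum 'I_d) hD; rewrite -/S => hS.
have := rational_in_iter b (@derivation_sderiv _) (@box_deriv d) hS => hb.
have := rational_in_Xn a hb.
have w_le : (1 + S + b <= 1 + d.+1 * L)%N by lia.
move=> /(rational_in_pad w_le) [q qD gq]; exists q => //.
apply: box_le qD.
set W := (1 + d.+1 * L)%N in w_le *.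
(* The [S + b] derivatives and the padding exponent add up to [(d+1) L], each unit costing at most
   [c + 1]; the power of z costs at most [L]. *)
have : ((W - (1 + S + b)) * c <= (W - (1 + S + b)) * c.+1)%N by rewrite leq_mul.
have -> : ((D0 + c.+1 * d.+1 + 1) * L = D0 * L + (d.+1 * L) * c.+1 + L)%N by lia.
have -> : (d.+1 * L = (W - (1 + S + b)) + (S + b))%N by rewrite /W in w_le *; lia.
have : (D0 <= D0 * L)%N by rewrite leq_pmulr //; lia.
by rewrite !mulnDl; lia.
Qed.

End RationalSeries.

(** * From an annihilating operator to a differential equation for the residue *)

Section ConstantTermODE.
Variable d : nat.
Implicit Types (h g : nat -> laurent d) (m : 'rV[int]_d).

Lemma lcoef_pactXn a g n m :
  lcoef (pact 'X^a g n) m = pact 'X^a (fun i => lcoef (g i) m) n.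
Proof. by rewrite !pactXn; case: ifP => // _; rewrite lcoef0. Qed.

Lemma lcoef_iter_sderiv b g n m : lcoef (iter b (@sderiv _) g n) m
  = iter b (@sderiv _) (fun i => lcoef (g i) m) n.
Proof.
elim: b n => [|b IHb] n //=.
by rewrite /sderiv !mulr_natl lcoefMn IHb.
Qed.

Lemma iter_sderiv_scale b (x : algC) (s : nat -> algC) n :
  iter b (@sderiv _) (fun i => x * s i) n = x * iter b (@sderiv _) s n.
Proof.
elim: b n => [|b IHb] n //=.
by rewrite /sderiv IHb mulrCA.
Qed.

Lemma pact_scale (x : algC) p (s : nat -> algC) n :
  pact p (fun i => x * s i) n = x * pact p s n.
Proof. by rewrite /pact mulr_sumr; apply: eq_bigr => j _; rewrite mulrCA. Qed.

Definition diffop (L : nat) h (t : 'I_L * 'I_L * {ffun 'I_d -> 'I_L}) :=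
  pact 'X^(t.1.1) (iter t.1.2 (@sderiv _)
    (fun n => lderivs (fun i => t.2 i : nat) (enum 'I_d) (h n))).

(* There are about L^(d+2) operators z^a dz^b dx^k with exponents below L, while,
   over the common denominator P^W, their values on h fill a space of dimension
   O(L^(d+1)). *)
Lemma rational_in_annihilator (P : {poly laurent d}) D0 h :
  P`_0 = 1 -> rational_in P 1 D0 h ->
  exists L (c : 'I_L * 'I_L * {ffun 'I_d -> 'I_L} -> algC),
    (exists t, c t != 0) /\ forall n, \sum_t lmono (c t) 0 * diffop h t n = 0.
Proof.
move=> P0 hD; have [e Pe] := box_exists P.
(* [K * L] is the numerator bound of [rational_in_operator]. *)
pose K := (D0 + e.+1 * d.+1 + 1)%N.
have [L L0 L_large] := @box_count_lt d K (ltn_addl _ (ltn0Sn 0)).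
pose T : finType := ('I_L * 'I_L * {ffun 'I_d -> 'I_L})%type.
pose W := (1 + d.+1 * L)%N.
have rat_op (t : T) : exists q, box (K * L) q /\
    forall n, pact (P ^+ W) (diffop h t) n = q`_n.
  have [q qb qE] := rational_in_operator Pe hD (ltn_ord t.1.1) (ltn_ord t.1.2)
    (fun i => ltn_ord (t.2 i)).
  by exists q.
have {rat_op} [q qP] := choice rat_op.
pose J : finType := ('I_(K * L).+1 * {ffun 'I_d -> 'I_(2 * (K * L)).+1})%type.
(* Indices from 0 to [2KL] are shifted to exponents from [-KL] to [KL]. *)
pose row (f : {ffun 'I_d -> 'I_(2 * (K * L)).+1}) : 'rV[int]_d :=
  \row_i ((f i)%:Z - (K * L)%:Z).
have JT : (#|J| < #|T|)%N.
  by rewrite !card_prod !card_ffun !card_ord.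
have [c c0 cP] :=
  linear_relation (fun (t : T) (j : J) => lcoef (q t)`_j.1 (row j.2)) JT.
exists L, c; split=> //.
have qsum n : \sum_t lmono (c t) 0 * (q t)`_n = 0.
  apply: lcoefP => m; rewrite lcoef_sum lcoef0.
  under eq_bigr do rewrite lcoef_lmonoM subr0.
  have [[nK mK]|] :=
      pselect ((n <= K * L)%N /\ forall j, (absz (m 0%R j) <= K * L)%N).
    have mf j : (absz (m 0%R j + (K * L)%:Z)%R < (2 * (K * L)).+1)%N.
      by move: (mK j); move: (m 0 j) (K * L)%N => z k; lia.
    have := cP (Ordinal (nK : (n < (K * L).+1)%N), [ffun j => Ordinal (mf j)]).
    rewrite (_ : row _ = m) //; apply/rowP => j; rewrite mxE ffunE /=.
    by move: (mK j); move: (m 0 j) (K * L)%N => z k; lia.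
  move=> nbox; rewrite big1 // => t _; case: (qP t) => qb _.
  have [->|/qb //] := eqVneq (lcoef (q t)`_n m) 0.
  by rewrite mulr0.
(* The common denominator has constant coefficient 1, so it can be cancelled. *)
apply: (@pact_eq0 _ (P ^+ W)).
  by rewrite -horner_coef0 horner_exp horner_coef0 P0 expr1n.
move=> n; rewrite (pact_sum (P ^+ W) (fun t => lmono (c t) 0) (fun t => diffop h t)).
by rewrite -[RHS](qsum n); apply: eq_bigr => t _; rewrite (qP t).2.
Qed.

(* Among the x-derivatives dx^k occurring in an annihilating operator take k of
   minimal total order: reading off the coefficient of x^(-1-k) kills all the
   others and leaves an operator in z alone applied to the residue. *)
Lemma rational_in_ode (P : {poly laurent d}) D0 h :
  P`_0 = 1 -> rational_in P 1 D0 h ->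
  satisfies_linear_ode (fun n => lcoef (h n) (const_mx (-1))).
Proof.
move=> P0 hD; have [L [c [[t0 ct0] cP]]] := rational_in_annihilator P0 hD.
pose ord (t : 'I_L * 'I_L * {ffun 'I_d -> 'I_L}) := (\sum_i t.2 i)%N.
case: (@arg_minnP _ t0 (fun t => c t != 0) ord ct0) => -[[a1 b1] k0] /= ct1 t1_min.
pose m0 : 'rV[int]_d := \row_i (-1 - (k0 i)%:Z).
(* The factor by which [lcoef_lderivs] multiplies the coefficient at [m0]. *)
pose kappa (k : {ffun 'I_d -> 'I_L}) : algC :=
  (\prod_(i <- enum 'I_d) \prod_(t < k i) (m0 0%R i + t.+1%:Z))%:~R.
have kappa_eq0 (k : {ffun 'I_d -> 'I_L}) i : (k0 i < k i)%N -> kappa k = 0.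
  move=> ki; rewrite /kappa big_enum /= (bigD1 i) //=.
  rewrite (bigD1 (Ordinal ki)) //= mxE.
  have -> : -1 - (k0 i)%:Z + (k0 i).+1%:Z = 0.
    by move: (nat_of_ord (k0 i)) => z; lia.
  by rewrite !mul0r.
have kappa_neq0 : kappa k0 != 0.
  rewrite intr_eq0 big_enum /=; apply/prodf_neq0 => i _; apply/prodf_neq0 => t _.
  rewrite mxE; have := ltn_ord t; move: (nat_of_ord t) => u.
  by move: (nat_of_ord (k0 i)) => v uv; lia.
(* If some [k i] exceeds [k0 i], then [kappa k] vanishes; otherwise [k] has smaller total order than
   [k0], and minimality gives [c (ab, k) = 0]. *)
have ckappa ab (k : {ffun 'I_d -> 'I_L}) : k != k0 -> c (ab, k) * kappa k = 0.
  move=> kk0; have [->|ck] := eqVneq (c (ab, k)) 0; first by rewrite mul0r.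
  have [i ki|k_le] := pickP (fun i => k0 i < k i)%N.
    by rewrite (kappa_eq0 _ i) // mulr0.
  have {}k_le i : (k i <= k0 i)%N by rewrite leqNgt k_le.
  have [i ki|k_ge] := pickP (fun i => k i < k0 i)%N; last first.
    case/eqP: kk0; apply/ffunP => i; apply/val_inj/eqP => /=.
    by rewrite eqn_leq k_le leqNgt k_ge.
  have := t1_min _ ck; rewrite /ord /= leqNgt => /negP[].
  rewrite (bigD1 i) // [ltnRHS](bigD1 i) //= -addSn leq_add //.
  exact: leq_sum.
pose s n := lcoef (h n) (const_mx (-1)).
pose S (ab : 'I_L * 'I_L) n := pact 'X^(nat_of_ord ab.1) (iter (nat_of_ord ab.2) (@sderiv _) s) n.
have rel n : \sum_ab c (ab, k0) * S ab n = 0.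
  have := congr1 (fun f => lcoef f m0) (cP n); rewrite lcoef0 lcoef_sum.
  have termE (t : 'I_L * 'I_L * {ffun 'I_d -> 'I_L}) :
      lcoef (lmono (c t) 0 * diffop h t n) m0
      = if t.2 == k0 then kappa k0 * (c (t.1, t.2) * S t.1 n) else 0.
    case: t => [[a b] k]; rewrite lcoef_lmonoM subr0 lcoef_pactXn /=.
    rewrite (_ : (fun i => _) = iter b (@sderiv _)
        (fun i => kappa k * lcoef (h i) (m0 + \sum_i evec i *+ k i))); last first.
      apply: funext => i; rewrite lcoef_iter_sderiv; congr (iter _ _ _ _).
      apply: funext => j; rewrite lcoef_lderivs ?enum_uniq // big_enum /=.
      by rewrite big_enum /= /kappa big_enum.
    rewrite (eq_pact _ (iter_sderiv_scale _ _ _)) pact_scale mulrA.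
    have [->|/ckappa ->] := eqVneq k k0; last by rewrite mul0r.
    (* For [k = k0] the exponent [m0 + k0] is [(-1, ..., -1)], that of the residue. *)
    rewrite mulrAC mulrC; congr (_ * (_ * pact _ (iter _ _ _) _)).
    apply: funext => i; congr lcoef; apply/rowP => j.
    rewrite !mxE summxE (bigD1 j) //= mulmxnE evecE eqxx mulr1n big1.
      by rewrite addr0 natz subrK.
    by move=> l lj; rewrite mulmxnE evecE eq_sym (negbTE lj) mul0rn.
  under eq_bigr do rewrite termE.
  rewrite -big_mkcond /=.
  rewrite (eq_bigl (fun t => (true && (t.2 == k0)))) //.
  rewrite -(pair_big predT (pred1 k0)
    (fun ab k => kappa k0 * (c (ab, k) * S ab n))) /=.
  under eq_bigr do rewrite big_pred1_eq.
  by rewrite -mulr_sumr => /eqP; rewrite mulf_eq0 (negbTE kappa_neq0) => /eqP.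
pose p (b : 'I_L) : {poly algC} := \sum_(a < L) c (a, b, k0) *: 'X^a.
exists L, p; split.
  (* The coefficient of [p b1] at [a1] is the nonzero [c (a1, b1, k0)]. *)
  exists b1; apply: contraNneq ct1 => /(congr1 (fun p : {poly algC} => p`_a1)).
  rewrite coef0 coef_sum (bigD1 a1) //= coefZ coefXn eqxx mulr1 big1 ?addr0.
    by move->.
  move=> a aa1; rewrite coefZ coefXn (_ : (_ == _) = false) ?mulr0 //.
  by rewrite eq_sym; apply: negbTE.
move=> n; rewrite -[RHS](rel n).
transitivity (\sum_a \sum_b c (a, b, k0) * S (a, b) n); last first.
  by rewrite pair_bigA; apply: eq_bigr => -[a b].
rewrite [RHS]exchange_big /=.
apply: eq_bigr => b _.
exact: (pact_suml (fun a : 'I_L => 'X^a) (fun a => c (a, b, k0))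
  (iter b (@sderiv _) s) n).
Qed.

End ConstantTermODE.

(** * Moment series of matrices and the conclusion *)

Lemma moment_series_mx_ode d N (F : 'M[laurent d]_N) :
  satisfies_linear_ode (moment_series_mx F).
Proof.
case: N F => [|N] F.
  (* For an empty matrix the series is zero and satisfies the equation [y = 0] of order 0. *)
  exists 1%N, (fun=> 1); split; first by exists 0; rewrite oner_neq0.
  move=> n; rewrite big_ord1 /ps_mulp big1 // => j _ /=.
  by rewrite moment_series_mxE big_ord0 mulr0.
pose h n : laurent d := lmono 1 (const_mx (-1)) * \tr (F ^+ n).
have -> : moment_series_mx F = fun n => lcoef (h n) (const_mx (-1)).
  by apply: funext => n; rewrite lcoef_lmonoM mul1r subrr.
pose chi := char_poly F.
have chi_size : size chi = N.+2 := size_char_poly F.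
(* This is [det(1 - z F)]; its constant coefficient is the leading coefficient of [chi]. *)
pose P := \poly_(j < N.+2) chi`_(N.+1 - j).
have P0 : P`_0 = 1.
  rewrite coef_poly /= subn0; have /monicP := char_poly_monic F.
  by rewrite lead_coefE chi_size.
(* From index [N.+1] on, the convolution is the trace of Cayley-Hamilton multiplied by a power of
   [F]. *)
have hP n : (N.+1 <= n)%N -> pact P h n = 0.
  move=> Nn; pose r := (n - N.+1)%N.
  have chiF : \sum_(i < N.+2) chi`_i *: F ^+ (i + r) = 0.
    have := congr1 (fun M => M * F ^+ r) (Cayley_Hamilton F).
    rewrite /= mul0r -/chi -[in LHS](coefK chi) poly_def chi_size linear_sum /=.
    rewrite mulr_suml => {2}<-; apply: eq_bigr => i _.
    by rewrite linearZ /= rmorphXn /= horner_mx_X -scalerAl exprD.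
  transitivity (\sum_(j < N.+2) chi`_(N.+1 - j) * h (n - j)%N).
    rewrite (big_ord_widen n.+1 (fun j => chi`_(N.+1 - j) * h (n - j)%N)) //.
    rewrite [RHS]big_mkcond; apply: eq_bigr => j _; rewrite coef_poly.
    by case: ifP => // _; rewrite mul0r.
  rewrite (reindex_inj rev_ord_inj) /=.
  transitivity (lmono 1 (const_mx (-1))
      * \tr (\sum_(i < N.+2) chi`_i *: F ^+ (i + r))).
    rewrite linear_sum /= mulr_sumr; apply: eq_bigr => i _.
    have iN := ltn_ord i; rewrite linearZ /= /h mulrCA subSS.
    rewrite (_ : N.+1 - (N.+1 - i) = i)%N; last by lia.
    by rewrite (_ : n - (N.+1 - i) = i + r)%N //; rewrite /r; lia.
  by rewrite chiF linear0 mulr0.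
have [D0 D0P] := box_exists (\poly_(n < N.+1) pact P h n).
apply: (@rational_in_ode _ P D0) => //.
exists (\poly_(n < N.+1) pact P h n) => // n.
by rewrite expr1 coef_poly ltnS; case: leqP => // /hP.
Qed.

Lemma moment_series_mx_G_function d N (F : 'M[laurent d]_N) :
  G_function (moment_series_mx F).
Proof.
by split; [exact: moment_series_mx_growth|exact: moment_series_mx_ode].
Qed.

Lemma moment_series_scalar d (F : laurent d) :
  moment_series F = moment_series_mx (F%:M : 'M_1).
Proof.
apply: funext => n; rewrite moment_series_mxE big_ord1 /moment_series /const_term.
by rewrite -(rmorphXn (@scalar_mx _ 1)) mxE eqxx.
Qed.

Theorem theorem1p19 (R : realType) (d : nat) :
  (exists t : laurent d -> special_term,
     (forall F : laurent d,
        moment_series F =1 special_series (t F) /\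
        G_function (moment_series F))
     /\
     ((forall F : laurent d, combinatorial_simplex (@newton_polytope R (t F)))
      /\
      (forall F F' : laurent d, monomials F = monomials F' ->
         existT (fun r => set 'rV[R]_r) _ (@newton_polytope R (t F)) =
         existT (fun r => set 'rV[R]_r) _ (@newton_polytope R (t F')))))
  /\
  (forall (N : nat) (F : 'M[laurent d]_N), G_function (moment_series_mx F)).
Proof.
split; last by move=> N F; exact: moment_series_mx_G_function.
have [t [t_series [m [tm m_mono]]]] := special_terms_exist R d.
exists t; split.
  move=> F; split; first exact: t_series.
  by rewrite moment_series_scalar; exact: moment_series_mx_G_function.
split=> [F|F F' FF']; last by rewrite !tm (m_mono F F').
(* As a predicate on dependent pairs, the property can be rewritten along [tm] although the ranks
   differ syntactically. *)
pose simplex (x : {r : nat & set 'rV[R]_r}) := combinatorial_simplex (projT2 x).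
have : simplex (existT (fun r => set 'rV[R]_r) _ (@std_simplex R (m F))).
  exact: std_simplex_combinatorial.
by rewrite -tm.
Qed.
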